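(* For every integer $d\ge 1$ there exists a constant $c(d)>0$, depending only on $d$, such that the following holds. Let $n\ge 1$, let $X,X_1,\dots,X_n$ be independent identically distributed real-valued random variables, let $a=(a_1,\dots,a_n)$ with $a_k\in\mathbf{R}^d$, let $F_a$ be the distribution of $S_a=\sum_{k=1}^n X_k a_k$, and let $G$ be the distribution of the symmetrized random variable $\widetilde X$ (the difference of two independent copies of $X$). For any $\varepsilon,\tau>0$, put $$\lambda=\lambda(G,\tau/\varepsilon)=\int_{z\in\mathbf{R}}\big(1+\lfloor\tau(\varepsilon|z|)^{-1}\rfloor\big)^{-d}\,G\{dz\}.$$ If $\lambda>0$, then $$Q(F_a,\tau)\le c(d)\,\lambda^{-1}\,Q(H_1^{\lambda},\varepsilon),$$ where $H_1^{\lambda}$ is the infinitely divisible distribution on $\mathbf{R}^d$ with characteristic function $$t\mapsto\exp\Big(-\frac{\lambda}{2}\sum_{k=1}^{n}\big(1-\cos\langle t,a_k\rangle\big)\Big),\quad t\in\mathbf{R}^d.$$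
   Context: The concentration function of a random vector $Y$ in $\mathbf{R}^d$ with distribution $F=\mathcal{L}(Y)$ is $Q(F,\lambda)=\sup_{x\in\mathbf{R}^d}\mathbf{P}(Y\in x+\lambda B)$ for $0\le\lambda\le\infty$, where $B=\{x\in\mathbf{R}^d:\|x\|\le 1/2\}$ and $\|\cdot\|$ is the Euclidean norm; in particular $Q(F,\infty)=1$. Non-standard convention: $\lfloor x\rfloor$ denotes the largest integer $k$ such that $k<x$ (strict inequality), so that $\lfloor\tau(\varepsilon|z|)^{-1}\rfloor=0$ whenever $|z|\ge\tau/\varepsilon$. For $z=0$ the integrand $\big(1+\lfloor\tau(\varepsilon|z|)^{-1}\rfloor\big)^{-d}$ is understood as $0$. $\langle\cdot,\cdot\rangle$ is the scalar product in $\mathbf{R}^d$. For an infinitely divisible distribution $F$ with characteristic function $\widehat F$ and $\lambda\ge 0$, $F^{\lambda}$ denotes the infinitely divisible distribution with characteristic function $\widehat F^{\lambda}(t)$; $H_1$ is the symmetric infinitely divisible distribution with characteristic function $\exp\big(-\frac12\sum_{k=1}^n(1-\cos\langle t,a_k\rangle)\big)$. *)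

(* Defs.v *)
(* R^d is represented by the row vectors ['rV[R]_d], R : realType. *)
From HB Require Import structures.
From mathcomp Require Import all_boot all_order all_algebra.
From mathcomp Require Import all_classical all_reals all_analysis measurable_realfun.
From mathcomp Require Import complex.

Set Implicit Arguments.
Unset Strict Implicit.
Unset Printing Implicit Defensive.

Import Order.TTheory GRing.Theory Num.Theory.
Import numFieldNormedType.Exports.

Local Open Scope classical_set_scope.
Local Open Scope ring_scope.
Local Open Scope complex_scope.

(* The Borel sigma-algebra of R^d, presented as the library does for
   [d.-tuple R]: generated by the Borel cylinders over the coordinates. *)
Section row_measurable.
Variables (R : realType) (d : nat).

Definition coordinate (i : 'I_d) (x : 'rV[R]_d) : R := x 0 i.

Let row_set0 : g_sigma_preimage coordinate set0.
Proof. exact: sigma_algebra0. Qed.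

Let row_setC A : g_sigma_preimage coordinate A ->
  g_sigma_preimage coordinate (~` A).
Proof. exact: sigma_algebraC. Qed.

Let row_bigcup (F : (set 'rV[R]_d)^nat) :
  (forall i, g_sigma_preimage coordinate (F i)) ->
  g_sigma_preimage coordinate (\bigcup_i F i).
Proof. exact: sigma_algebra_bigcup. Qed.

HB.instance Definition _ := @isMeasurable.Build default_measure_display
  'rV[R]_d (g_sigma_preimage coordinate) row_set0 row_setC row_bigcup.

Lemma measurable_coordinate (i : 'I_d) :
  measurable_fun [set: 'rV[R]_d] (coordinate i).
Proof.
move=> _ Y mY; rewrite setTI; apply: sub_sigma_algebra => /=.
rewrite -bigcup_seq/=; exists i => /=; first by rewrite mem_index_enum.
by exists Y => //; rewrite setTI.
Qed.

Lemma measurable_fun_rowP (disp : measure_display) (T : measurableType disp)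
    (f : T -> 'rV[R]_d) :
  measurable_fun [set: T] f <->
  forall i, measurable_fun [set: T] (fun w => f w 0 i).
Proof.
split=> [mf i|mf].
  by apply: (measurableT_comp (measurable_coordinate i) mf).
apply: (@measurability _ _ T 'rV[R]_d setT f
  (\big[setU/set0]_(i < d) preimage_set_system setT (coordinate i)
     measurable)) => //.
move=> _ [B + <-]; rewrite -bigcup_seq/= => -[i _ [A mA <-]].
have := mf i measurableT A mA.
by rewrite !setTI.
Qed.

End row_measurable.

Section euclidean.
Variables (R : realType) (d : nat).
Implicit Types x y : 'rV[R]_d.

Definition dotp x y : R := \sum_i x 0 i * y 0 i.

(* The library's norm on ['rV[R]_d] is the sup norm. *)
Definition enorm x : R := Num.sqrt (dotp x x).

(* The ball B of the concentration function has radius 1/2. *)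
Definition half_ball : set 'rV[R]_d := [set x | enorm x <= 1 / 2].

(* Q(F, r), for finite r only: r *: b makes no sense at r = +oo. *)
Definition concentration (F : set 'rV[R]_d -> \bar R) (r : R) : \bar R :=
  ereal_sup [set F [set x + r *: b | b in half_ball] | x in [set: 'rV[R]_d]].

Definition char_fun (F : probability 'rV[R]_d R) (t : 'rV[R]_d) : R[i] :=
  (\int[F]_x cos (dotp t x)) +i* (\int[F]_x sin (dotp t x)).

End euclidean.

Section pair_difference.
Context {R : realType}.

Definition pair_difference (z : R * R) : R := z.1 - z.2.

Let measurable_pair_difference :
  measurable_fun [set: R * R] pair_difference.
Proof.
apply: measurable_funB; [exact: measurable_fst|exact: measurable_snd].
Qed.

HB.instance Definition _ := @isMeasurableFun.Build _ _ _ _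
  pair_difference measurable_pair_difference.

End pair_difference.

Section random_variables.
Context {disp : measure_display} {T : measurableType disp} {R : realType}.
Variable P : probability T R.

Definition mutually_independent (I : finType) (X : I -> {RV P >-> R}) : Prop :=
  forall (J : {set I}) (A : I -> set R), (forall i, measurable (A i)) ->
    P (\bigcap_(i in [set` J]) (X i @^-1` A i)) =
    (\prod_(i in J) P (X i @^-1` A i))%E.

(* The laws are compared on measurable sets only: [distribution P X] has no
   meaning elsewhere. *)
Definition identically_distributed (I : finType) (X : I -> {RV P >-> R}) :
    Prop :=
  forall (i j : I) (A : set R), measurable A ->
    distribution P (X i) A = distribution P (X j) A.

Definition iid (I : finType) (X : I -> {RV P >-> R}) : Prop :=
  mutually_independent X /\ identically_distributed X.

Definition weighted_sum (n d : nat) (X : 'I_n -> {RV P >-> R})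
  (a : 'I_n -> 'rV[R]_d) (w : T) : 'rV[R]_d := \sum_(k < n) X k w *: a k.

Let measurable_weighted_sum n d (X : 'I_n -> {RV P >-> R})
  (a : 'I_n -> 'rV[R]_d) : measurable_fun [set: T] (weighted_sum X a).
Proof.
apply/measurable_fun_rowP => i.
under eq_fun do rewrite summxE.
apply: measurable_sum => k; under eq_fun do rewrite mxE.
by apply: measurable_funM => //; exact: measurable_funPT.
Qed.

HB.instance Definition _ n d (X : 'I_n -> {RV P >-> R})
  (a : 'I_n -> 'rV[R]_d) := @isMeasurableFun.Build _ _ _ _
  (weighted_sum X a) (measurable_weighted_sum X a).

(* The law of X' - X'' for independent copies X', X'' of X. *)
Definition symmetrized_distribution (X : {RV P >-> R}) :
    probability R R :=
  distribution (distribution P X \x distribution P X)%E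
    pair_difference.

End random_variables.

Section lambda.
Variable R : realType.

(* The largest integer that is strictly less than x. *)
Definition strict_floor (x : R) : int := Num.ceil x - 1.

Lemma strict_floorP (x : R) :
  (strict_floor x)%:~R < x /\ forall k : int, k%:~R < x -> k <= strict_floor x.
Proof.
split=> [|k kx]; first exact: ceilB1_lt.
by rewrite /strict_floor lerBrDr lezD1 ceil_gt_int.
Qed.

Definition lambda_integrand (d : nat) (eps tau z : R) : R :=
  if z == 0 then 0
  else (1 + (strict_floor (tau * (eps * `|z|)^-1))%:~R) ^- d.

Definition lambda (d : nat) (G : probability R R)
    (eps tau : R) : R :=
  \int[G]_z lambda_integrand d eps tau z.

End lambda.

(* Main.v *)
From HB Require Import structures.
Require Import Defs.
From mathcomp Require Import all_boot all_order all_algebra.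
From mathcomp Require Import all_classical all_reals all_analysis measurable_realfun.
From mathcomp Require Import complex.
From mathcomp Require Import ring lra.

Set Implicit Arguments.
Unset Strict Implicit.
Unset Printing Implicit Defensive.

Import Order.TTheory GRing.Theory Num.Theory.
Import numFieldNormedType.Exports.

Local Open Scope classical_set_scope.
Local Open Scope ring_scope.
Local Open Scope complex_scope.

(** Fix the frequency law [nu] on R^d whose coordinates are independent and
    triangular on [-1, 1]. Its characteristic function k, a product of Fejer
    kernels, is nonnegative, is at least a positive constant on the ball of
    radius 1 / 2, and is dominated by a summable family of constants on the cells
    of any cubic grid of mesh at most 1.

    The lower bound on k gives Esseen's inequality ([ball_prob_le_char_fun]): up
    to a constant, the probability that S_a lies in x + tau B is at most the
    average over t of law [nu] of the modulus of the characteristic function of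
    S_a at t / tau. By independence ([independent_sum_char_fun_sqr]) and
    v <= exp (v - 1) that modulus is at most the exponential of minus the integral
    of h (z t / tau) over z of law G, where h (t) is half the sum over k of
    1 - cos <t, a_k> ([weighted_sum_cos_le]).

    Let w be the integrand of lambda. As 0 <= w <= 1, Jensen's inequality for the
    probability measure w G / lambda ([expR_expectation_le]) bounds this by
    1 / lambda times the integral over z of w (z) exp (- lambda h (z t / tau)).
    The exponential is the characteristic function of H_1^lambda at z t / tau, so
    after exchanging the integrals over t and z, the integral over t is the
    expectation of k (z Y / tau) for Y of law H_1^lambda.

    That expectation is the price of looking at H_1^lambda at scale tau / |z|
    ([lambda_integrand_fejer_le]). With m the ceiling of tau / (eps |z|), cells of
    side 1 / (m d) for z Y / tau correspond to boxes for Y of side at most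
    eps / d, which fit in balls of eps B; the sum of k over these cells is at most
    (24 m d) ^ d ([expectation_fejer_kernel_le]). Hence the expectation is at most
    (24 m d) ^ d Q (H_1^lambda, eps), and since w (z) = m ^ (- d), the factor
    m ^ d disappears. *)

(** * Expectations of bounded measurable functions *)

Section bounded_measurable.
Context {disp : measure_display} {T : measurableType disp} {R : realType}.
Implicit Types f g : T -> R.

(** Every expectation below is that of such a function under a probability
    measure; the closure properties that follow then replace all discussions of
    integrability. *)
Definition bounded_measurable f :=
  measurable_fun [set: T] f /\ exists M, forall x, `|f x| <= M.

Lemma bounded_measurable_cst (c : R) : bounded_measurable (fun=> c).
Proof. by split=> //; exists `|c|. Qed.

Lemma bounded_measurableD f g : bounded_measurable f ->
  bounded_measurable g -> bounded_measurable (fun x => f x + g x).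
Proof.
move=> [mf [M fM]] [mg [N gN]]; split; first exact: measurable_funD.
exists (M + N) => x; exact: le_trans (ler_normD _ _) (lerD _ _).
Qed.

Lemma bounded_measurableM f g : bounded_measurable f ->
  bounded_measurable g -> bounded_measurable (fun x => f x * g x).
Proof.
move=> [mf [M fM]] [mg [N gN]]; split; first exact: measurable_funM.
by exists (M * N) => x; rewrite normrM ler_pM.
Qed.

Lemma bounded_measurableB f g : bounded_measurable f ->
  bounded_measurable g -> bounded_measurable (fun x => f x - g x).
Proof.
move=> [mf [M fM]] [mg [N gN]]; split; first exact: measurable_funB.
exists (M + N) => x; exact: le_trans (ler_normB _ _) (lerD _ _).
Qed.

Lemma bounded_measurable_indic (A : set T) :
  measurable A -> bounded_measurable (\1_A : T -> R).
Proof.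
move=> mA; split; first exact: measurable_indic.
by exists 1 => x; rewrite indicE; case: (_ \in _); rewrite ?normr1 ?normr0.
Qed.

Lemma bounded_measurable_prod (I : eqType) (s : seq I) (F : I -> T -> R) :
  (forall i, bounded_measurable (F i)) ->
  bounded_measurable (fun x => \prod_(i <- s) F i x).
Proof.
move=> bF; elim: s => [|i s IHs].
  by under eq_fun do rewrite big_nil; exact: bounded_measurable_cst.
by under eq_fun do rewrite big_cons; exact: bounded_measurableM.
Qed.

Lemma bounded_measurable_sum (I : eqType) (s : seq I) (F : I -> T -> R) :
  (forall i, bounded_measurable (F i)) ->
  bounded_measurable (fun x => \sum_(i <- s) F i x).
Proof.
move=> bF; elim: s => [|i s IHs].
  by under eq_fun do rewrite big_nil; exact: bounded_measurable_cst.
by under eq_fun do rewrite big_cons; exact: bounded_measurableD.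
Qed.

Lemma bounded_measurable_cos f :
  measurable_fun [set: T] f -> bounded_measurable (fun x => cos (f x)).
Proof.
move=> mf; split.
  have mcos := continuous_measurable_fun (@continuous_cos R).
  exact: measurableT_comp mcos mf.
by exists 1 => x; rewrite ler_norml cos_geN1 cos_le1.
Qed.

Lemma bounded_measurable_sin f :
  measurable_fun [set: T] f -> bounded_measurable (fun x => sin (f x)).
Proof.
move=> mf; split.
  have msin := continuous_measurable_fun (@continuous_sin R).
  exact: measurableT_comp msin mf.
by exists 1 => x; rewrite ler_norml sin_geN1 sin_le1.
Qed.

Lemma bounded_measurable_expRN f : measurable_fun [set: T] f ->
  (forall x, 0 <= f x) -> bounded_measurable (fun x => expR (- f x)).
Proof.
move=> mf f0; split.
  by apply: measurableT_comp => //; exact: measurable_funN.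
by exists 1 => x; rewrite ger0_norm ?expR_ge0// expR_le1 oppr_le0.
Qed.

End bounded_measurable.

Lemma bounded_measurable_comp d1 d2 (T1 : measurableType d1)
    (T2 : measurableType d2) (R : realType) (f : T2 -> R) (g : T1 -> T2) :
  bounded_measurable f -> measurable_fun [set: T1] g ->
  bounded_measurable (fun x => f (g x)).
Proof.
move=> [mf [M fM]] mg; split; first exact: measurableT_comp.
by exists M => x.
Qed.

Section bounded_expectation.
Context {disp : measure_display} {T : measurableType disp} {R : realType}.
Variable P : probability T R.
Implicit Types f g : T -> R.

Lemma bounded_measurable_integrable f :
  bounded_measurable f -> P.-integrable [set: T] (EFin \o f).
Proof.
move=> [mf [M fM]]; apply: measurable_bounded_integrable => //.
  by rewrite -ge0_fin_numE ?fin_num_measure.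
exists M; split=> [|x /ltW Mx y _]; first exact: num_real.
exact: le_trans (fM y) Mx.
Qed.

Lemma EFin_expectation f : bounded_measurable f ->
  (\int[P]_x f x)%:E = (\int[P]_x (f x)%:E)%E.
Proof.
move=> bf; rewrite /Rintegral fineK//; apply: integrable_fin_num => //.
exact: bounded_measurable_integrable.
Qed.

Lemma expectation_add f g : bounded_measurable f -> bounded_measurable g ->
  \int[P]_x (f x + g x) = \int[P]_x f x + \int[P]_x g x.
Proof.
by move=> bf bg; rewrite RintegralD//; exact: bounded_measurable_integrable.
Qed.

Lemma expectation_sub f g : bounded_measurable f -> bounded_measurable g ->
  \int[P]_x (f x - g x) = \int[P]_x f x - \int[P]_x g x.
Proof.
by move=> bf bg; rewrite RintegralB//; exact: bounded_measurable_integrable.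
Qed.

Lemma expectation_scale f c : bounded_measurable f ->
  \int[P]_x (c * f x) = c * \int[P]_x f x.
Proof.
by move=> bf; rewrite RintegralZl//; exact: bounded_measurable_integrable.
Qed.

Lemma expectation_constant c : \int[P]_x c = c.
Proof.
rewrite Rintegral_cst// [X in fine X](_ : _ = 1%E) ?mulr1//.
exact: probability_setT.
Qed.

Lemma expectation_sum_fin (I : eqType) (s : seq I) (F : I -> T -> R) :
  (forall i, bounded_measurable (F i)) ->
  \int[P]_x (\sum_(i <- s) F i x) = \sum_(i <- s) \int[P]_x F i x.
Proof.
move=> bF; elim: s => [|i s IHs].
  by under eq_Rintegral do rewrite big_nil; rewrite big_nil expectation_constant.
rewrite big_cons -IHs -expectation_add//; last exact: bounded_measurable_sum.
by apply: eq_Rintegral => x _; rewrite big_cons.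
Qed.

Lemma expectation_mono f g : bounded_measurable f -> bounded_measurable g ->
  (forall x, f x <= g x) -> \int[P]_x f x <= \int[P]_x g x.
Proof.
move=> bf bg fg; apply: le_Rintegral => //;
  exact: bounded_measurable_integrable.
Qed.

Lemma expectation_norm_le f M : bounded_measurable f ->
  (forall x, `|f x| <= M) -> `|\int[P]_x f x| <= M.
Proof.
move=> bf fM; rewrite ler_norml; apply/andP; split.
  rewrite -[leLHS]expectation_constant; apply: expectation_mono => //.
    exact: bounded_measurable_cst.
  by move=> x; have := fM x; rewrite ler_norml => /andP[].
rewrite -[leRHS]expectation_constant; apply: expectation_mono => //.
  exact: bounded_measurable_cst.
by move=> x; have := fM x; rewrite ler_norml => /andP[].
Qed.

Lemma expectation_indicator (A : set T) : measurable A ->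
  \int[P]_x \1_A x = fine (P A).
Proof. by move=> mA; rewrite /Rintegral integral_indic// setIT. Qed.

End bounded_expectation.

Lemma expectation_distribution d1 d2 (T1 : measurableType d1)
    (T2 : measurableType d2) (R : realType) (P : probability T1 R)
    (X : {RV P >-> T2}) (f : T2 -> R) : bounded_measurable f ->
  \int[distribution P X]_y f y = \int[P]_x f (X x).
Proof.
move=> bf; rewrite /Rintegral integral_distribution//.
  by apply/measurable_EFinP; case: bf.
apply: (@bounded_measurable_integrable _ _ _ P (f \o X)).
exact: bounded_measurable_comp.
Qed.

Section expectation_fubini.
Context d1 d2 (T1 : measurableType d1) (T2 : measurableType d2) (R : realType).
Variables (P1 : probability T1 R) (P2 : probability T2 R).
Variables (f : T1 * T2 -> R) (bf : bounded_measurable f).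

Let integrable_f : (P1 \x P2)%E.-integrable setT (EFin \o f).
Proof. exact: bounded_measurable_integrable. Qed.

Let bounded_section1 x : bounded_measurable (fun y => f (x, y)).
Proof. exact: bounded_measurable_comp bf (pair1_measurable _). Qed.

Let bounded_section2 y : bounded_measurable (fun x => f (x, y)).
Proof. exact: bounded_measurable_comp bf (pair2_measurable _). Qed.

Lemma bounded_measurable_fubini1 :
  bounded_measurable (fun x => \int[P2]_y f (x, y)).
Proof.
split; last by case: bf => _ [M fM]; exists M => x; exact: expectation_norm_le.
apply: (measurableT_comp (fine_measurable measurableT)).
exact: (measurable_fubini_F integrable_f).
Qed.

Lemma bounded_measurable_fubini2 :
  bounded_measurable (fun y => \int[P1]_x f (x, y)).
Proof.
split; last by case: bf => _ [M fM]; exists M => y; exact: expectation_norm_le.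
apply: (measurableT_comp (fine_measurable measurableT)).
exact: (measurable_fubini_G integrable_f).
Qed.

Lemma expectation_product :
  \int[(P1 \x P2)%E]_z f z = \int[P1]_x \int[P2]_y f (x, y).
Proof.
rewrite /Rintegral -(integral12_prod_meas1 integrable_f); congr fine.
apply: eq_integral => x _; rewrite EFin_expectation//.
Qed.

Lemma expectation_fubini : \int[P1]_x \int[P2]_y f (x, y) =
  \int[P2]_y \int[P1]_x f (x, y).
Proof.
rewrite -expectation_product /Rintegral -(integral21_prod_meas1 integrable_f).
by congr fine; apply: eq_integral => y _; rewrite EFin_expectation.
Qed.

End expectation_fubini.

(** * Symmetrization *)

Section difference_law.
Variables (R : realType) (mu : probability R R).

(** The law of the difference of two independent variables of law [mu]; when
    [mu] is the law of X, this is the symmetrized distribution of X. *)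
Definition difference_law : probability R R :=
  distribution (mu \x mu)%E pair_difference.

(** Symmetrization turns the characteristic function of [mu] into the square of
    its modulus. *)
Lemma difference_law_cos u : \int[difference_law]_z cos (u * z) =
  (\int[mu]_x cos (u * x)) ^+ 2 + (\int[mu]_x sin (u * x)) ^+ 2.
Proof.
have mu_u : measurable_fun [set: R] (fun x => u * x).
  exact: measurable_funM.
have bc := bounded_measurable_cos mu_u.
have bs := bounded_measurable_sin mu_u.
rewrite expectation_distribution// expectation_product; last first.
  apply: (bounded_measurable_comp bc); exact: measurable_funPT.
transitivity (\int[mu]_x ((\int[mu]_y cos (u * y)) * cos (u * x) +
    (\int[mu]_y sin (u * y)) * sin (u * x))).
  apply: eq_Rintegral => x _.
  rewrite mulrC [X in _ = _ + X]mulrC -!expectation_scale//.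
  rewrite -expectation_add; [|exact: bounded_measurableM (bounded_measurable_cst _) _..].
  by apply: eq_Rintegral => y _; rewrite /pair_difference/= mulrBr cosB.
rewrite expectation_add; [|exact: bounded_measurableM (bounded_measurable_cst _) _..].
by rewrite !expectation_scale.
Qed.

Lemma difference_law_sin u : \int[difference_law]_z sin (u * z) = 0.
Proof.
have mu_u : measurable_fun [set: R] (fun x => u * x).
  exact: measurable_funM.
have bc := bounded_measurable_cos mu_u.
have bs := bounded_measurable_sin mu_u.
rewrite expectation_distribution// expectation_product; last first.
  apply: (bounded_measurable_comp bs); exact: measurable_funPT.
transitivity (\int[mu]_x ((\int[mu]_y cos (u * y)) * sin (u * x) -
    (\int[mu]_y sin (u * y)) * cos (u * x))).
  apply: eq_Rintegral => x _.
  rewrite mulrC [X in _ = _ - X]mulrC -!expectation_scale//.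
  rewrite -expectation_sub; [|exact: bounded_measurableM (bounded_measurable_cst _) _..].
  by apply: eq_Rintegral => y _; rewrite /pair_difference/= mulrBr sinB.
rewrite expectation_sub; [|exact: bounded_measurableM (bounded_measurable_cst _) _..].
by rewrite !expectation_scale// mulrC subrr.
Qed.

End difference_law.

(** * A one-dimensional frequency law *)

Section uniform_law.
Variable R : realType.

(** The two Borel structures on R, the default one and the one that carries
    Lebesgue measure, have the same measurable sets but are different terms;
    pushing forward along this identity moves a law from one to the other. *)
Definition real_of_measurableTypeR : measurableTypeR R -> R := idfun.

Let measurable_real_of_measurableTypeR :
  measurable_fun [set: measurableTypeR R] real_of_measurableTypeR.
Proof. exact: measurable_id. Qed.

HB.instance Definition _ := @isMeasurableFun.Build _ _ (measurableTypeR R) R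
  real_of_measurableTypeR measurable_real_of_measurableTypeR.

Definition uniform_law : probability R R :=
  distribution (uniform_prob (@ltr01 R)) real_of_measurableTypeR.

End uniform_law.

Section fejer.
Variable R : realType.
Local Notation U := (uniform_law R).

Lemma expectation_uniform (f : R -> R) : measurable_fun [set: R] f ->
  (forall x, 0 <= f x) ->
  \int[U]_x f x = \int[lebesgue_measure]_(x in `[0, 1]) f x.
Proof.
move=> mf f0; rewrite /Rintegral ge0_integral_distribution; last 2 first.
- exact/measurable_EFinP.
- by move=> x; rewrite lee_fin.
rewrite integral_uniform.
- by rewrite subr0 invr1 mul1e.
- exact/measurable_EFinP.
- by move=> x; rewrite lee_fin.
Qed.

(** The sign condition comes from the integral formula for the uniform law; cos
    and sin satisfy it after 1 is added to them. *)
Lemma expectation_uniform_derive (f F : R -> R) :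
  (forall x : R, is_derive x 1 F (f x)) -> continuous f -> (forall x, 0 <= f x) ->
  \int[U]_x f x = F 1 - F 0.
Proof.
move=> dF cf f0; rewrite expectation_uniform//; last first.
  exact: continuous_measurable_fun.
have cF : continuous F.
  move=> x; apply: differentiable_continuous; apply/derivable1_diffP.
  exact: (@ex_derive _ _ _ _ _ _ _ (dF x)).
rewrite /Rintegral (@continuous_FTC2 _ _ F)//.
- exact: continuous_in_subspaceT.
- split.
  + by move=> x _; exact: ex_derive.
  + exact/cvg_at_right_filter/cF.
  + exact/cvg_at_left_filter/cF.
- by move=> x _; rewrite derive1E (@derive_val _ _ _ _ _ _ _ (dF x)).
Qed.

Lemma continuous_mull (u : R) : continuous (fun x : R => u * x).
Proof. by move=> x; apply: cvgM; [exact: cvg_cst|exact: cvg_id]. Qed.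

Lemma expectation_uniform_cos (u : R) : u != 0 ->
  \int[U]_x cos (u * x) = sin u / u.
Proof.
move=> u0; have mu_u : measurable_fun [set: R] (fun x => u * x).
  exact: measurable_funM.
have bc := bounded_measurable_cos mu_u.
have : \int[U]_x (1 + cos (u * x)) = 1 + sin u / u.
  have dF (x : R) : is_derive x 1 (fun x : R => x + u^-1 * sin (u * x))
      (1 + cos (u * x)).
    apply: is_derive_eq.
    rewrite /= ?scaler0 ?addr0 ?scaler1 /GRing.scale/=. by field.
  rewrite (expectation_uniform_derive dF).
  - by rewrite mulr1 mulr0 sin0 mulr0 addr0 subr0 mulrC.
  - move=> x; apply: cvgD; first exact: cvg_cst.
    exact: (continuous_comp (@continuous_mull u x) (@continuous_cos R _)).
  - by move=> x; rewrite -lerBlDl sub0r cos_geN1.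
rewrite expectation_add//; last exact: bounded_measurable_cst.
by rewrite expectation_constant => /addrI.
Qed.

Lemma expectation_uniform_sin (u : R) : u != 0 ->
  \int[U]_x sin (u * x) = (1 - cos u) / u.
Proof.
move=> u0; have mu_u : measurable_fun [set: R] (fun x => u * x).
  exact: measurable_funM.
have bc := bounded_measurable_sin mu_u.
have : \int[U]_x (1 + sin (u * x)) = 1 + (1 - cos u) / u.
  have dF (x : R) : is_derive x 1 (fun x : R => x - u^-1 * cos (u * x))
      (1 + sin (u * x)).
    apply: is_derive_eq.
    rewrite /= ?scaler0 ?addr0 ?scaler1 /GRing.scale/=. by field.
  rewrite (expectation_uniform_derive dF).
  - by rewrite mulr1 mulr0 cos0; ring.
  - move=> x; apply: cvgD; first exact: cvg_cst.
    exact: (continuous_comp (@continuous_mull u x) (@continuous_sin R _)).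
  - by move=> x; rewrite -lerBlDl sub0r sin_geN1.
rewrite expectation_add//; last exact: bounded_measurable_cst.
by rewrite expectation_constant => /addrI.
Qed.

Lemma expectation_uniform_cos_ge (u : R) : `|u| <= 1 / 2 ->
  cos (1 / 2) <= \int[U]_x cos (u * x).
Proof.
move=> u2; have mu_u : measurable_fun [set: R] (fun x => u * x).
  exact: measurable_funM.
have bc := bounded_measurable_cos mu_u.
rewrite -(lerD2l 1) -[X in _ <= X + _](expectation_constant U 1).
rewrite -expectation_add//; last exact: bounded_measurable_cst.
rewrite expectation_uniform; last 2 first.
- exact: (bounded_measurableD (bounded_measurable_cst 1) bc).1.
- by move=> x; rewrite -lerBlDl sub0r cos_geN1.
rewrite (_ : 1 + cos (1 / 2) =
  \int[lebesgue_measure]_(x in `[0%R, 1%R]) (1 + cos (1 / 2))); last first.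
  by rewrite Rintegral_cst//= lebesgue_measure_itv/= lte01 oppr0 addr0 mulr1.
have itg (g : R -> R) : bounded_measurable g ->
    (@lebesgue_measure R).-integrable `[0%R, 1%R] (EFin \o g).
  move=> [mg [M gM]]; apply: measurable_bounded_integrable => //.
  - by rewrite /= lebesgue_measure_itv/= lte01 oppr0 adde0 ltry.
  - exact: measurable_funTS.
  - by exists M; split=> [|x /ltW Mx y _];
      [exact: num_real|exact: le_trans (gM y) Mx].
apply: le_Rintegral => //.
- by apply: itg; exact: bounded_measurable_cst.
- by apply: itg; exact: bounded_measurableD (bounded_measurable_cst _) _.
move=> x /=; rewrite in_itv/= => /andP[x0 x1]; rewrite lerD2l.
rewrite -[X in _ <= X](_ : cos `|u * x| = _); last first.
  by case: (ger0P (u * x)) => // _; rewrite cosN.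
have uxle : `|u * x| <= 1 / 2.
  by rewrite normrM (ger0_norm x0); nra.
have p2 := pi_ge2 R; have ux0 := normr_ge0 (u * x).
rewrite leNgt; apply/negP; rewrite ltr_cos ?in_itv/=; last 2 first.
- by apply/andP; split; lra.
- by apply/andP; split; lra.
by apply/negP; rewrite -leNgt.
Qed.

(** The triangular law on [-1, 1]. Being a symmetrization, it has a nonnegative
    characteristic function. *)
Definition fejer_law : probability R R := difference_law U.

(** The Fejer kernel 2 (1 - cos u) / u ^ 2. *)
Definition fejer (u : R) : R := \int[fejer_law]_z cos (u * z).

Lemma fejer_ge0 u : 0 <= fejer u.
Proof. by rewrite /fejer difference_law_cos addr_ge0// sqr_ge0. Qed.

Lemma fejerN u : fejer (- u) = fejer u.
Proof. by apply: eq_Rintegral => z _; rewrite mulNr cosN. Qed.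

Lemma measurable_fejer : measurable_fun [set: R] fejer.
Proof.
have bcos : bounded_measurable (fun p : R * R => cos (p.1 * p.2)).
  by apply: bounded_measurable_cos; exact: measurable_funM.
exact: (bounded_measurable_fubini1 fejer_law fejer_law bcos).1.
Qed.

Lemma fejer_le1 u : fejer u <= 1.
Proof.
apply: le_trans (ler_norm _) _; apply: expectation_norm_le.
  by apply: bounded_measurable_cos; exact: measurable_funM.
by move=> x; rewrite ler_norml cos_geN1 cos_le1.
Qed.

Lemma fejer_le_inv_sqr u : u != 0 -> fejer u <= 4 / u ^+ 2.
Proof.
move=> u0; rewrite /fejer difference_law_cos.
rewrite expectation_uniform_cos// expectation_uniform_sin//.
rewrite !expr_div_n -mulrDl ler_pM2r ?invr_gt0 ?exprn_even_gt0//.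
have := cos2Dsin2 u; have := cos_geN1 u; have := cos_le1 u; nra.
Qed.

(** The lower bound of [fejer] on the ball of radius 1 / 2: the expectation of
    cos (u x) over x in [0, 1] is at least cos (1 / 2) there. *)
Definition fejer_min : R := cos (1 / 2) ^+ 2.

Lemma fejer_min_gt0 : 0 < fejer_min.
Proof.
by rewrite exprn_gt0// cos_gt0_pihalf//; have := pihalf_ge1 R; lra.
Qed.

Lemma fejer_ge_min u : `|u| <= 1 / 2 -> fejer_min <= fejer u.
Proof.
move=> u2; rewrite /fejer difference_law_cos.
apply: le_trans (_ : _ <= (\int[U]_x cos (u * x)) ^+ 2) _; last first.
  by rewrite lerDl sqr_ge0.
rewrite lerXn2r ?nnegrE ?expectation_uniform_cos_ge//.
  by apply/ltW; rewrite cos_gt0_pihalf//; have := pihalf_ge1 R; lra.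
apply: le_trans (expectation_uniform_cos_ge u2).
by apply/ltW; rewrite cos_gt0_pihalf//; have := pihalf_ge1 R; lra.
Qed.

End fejer.

(** * Product laws on R^d *)

Section row_vectors.
Context (R : realType).

Lemma measurable_fun_coord disp (T : measurableType disp) d (f : T -> 'rV[R]_d)
    (i : 'I_d) : measurable_fun [set: T] f ->
  measurable_fun [set: T] (fun w => f w 0 i).
Proof. by move=> /measurable_fun_rowP. Qed.

Lemma measurable_fun_dotp disp (T : measurableType disp) d
    (f g : T -> 'rV[R]_d) :
  measurable_fun [set: T] f -> measurable_fun [set: T] g ->
  measurable_fun [set: T] (fun w => dotp (f w) (g w)).
Proof.
move=> mf mg; rewrite /dotp; apply: measurable_sum => i.
by apply: measurable_funM; exact: measurable_fun_coord.
Qed.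

Lemma measurable_fun_scale disp (T : measurableType disp) d
    (c : T -> R) (f : T -> 'rV[R]_d) :
  measurable_fun [set: T] c -> measurable_fun [set: T] f ->
  measurable_fun [set: T] (fun w => c w *: f w).
Proof.
move=> mc mf; apply/measurable_fun_rowP => i; under eq_fun do rewrite mxE.
by apply: measurable_funM => //; exact: measurable_fun_coord.
Qed.

Lemma dotpZl d (c : R) (x y : 'rV[R]_d) : dotp (c *: x) y = c * dotp x y.
Proof. by rewrite /dotp mulr_sumr; apply: eq_bigr => i _; rewrite mxE mulrA. Qed.

Lemma dotpC d (x y : 'rV[R]_d) : dotp x y = dotp y x.
Proof. by apply: eq_bigr => i _; rewrite mulrC. Qed.

Lemma dotpZr d (c : R) (x y : 'rV[R]_d) : dotp x (c *: y) = c * dotp x y.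
Proof. by rewrite dotpC dotpZl dotpC. Qed.

Lemma dotpBr d (x y z : 'rV[R]_d) : dotp x (y - z) = dotp x y - dotp x z.
Proof.
by rewrite /dotp -sumrB; apply: eq_bigr => i _; rewrite !mxE mulrBr.
Qed.

Lemma dotp_sumr d n (x : 'rV[R]_d) (y : 'I_n -> 'rV[R]_d) :
  dotp x (\sum_k y k) = \sum_k dotp x (y k).
Proof.
rewrite /dotp exchange_big; apply: eq_bigr => i _.
by rewrite summxE mulr_sumr.
Qed.

End row_vectors.

Section cons_row.
Context (R : realType) (d : nat).

Definition cons_row (p : R * 'rV[R]_d) : 'rV[R]_d.+1 :=
  \row_i oapp (p.2 0) p.1 (unlift ord0 i).

Let measurable_cons_row : measurable_fun [set: R * 'rV[R]_d] cons_row.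
Proof.
apply/measurable_fun_rowP => i; under eq_fun do rewrite mxE.
case: (unliftP ord0 i) => [j|] _ /=; last exact: measurable_fst.
by apply: measurable_fun_coord; exact: measurable_snd.
Qed.

HB.instance Definition _ := @isMeasurableFun.Build _ _ _ _
  cons_row measurable_cons_row.

Lemma dotp_cons_row p (x : 'rV[R]_d.+1) :
  dotp (cons_row p) x = x 0 ord0 * p.1 + dotp p.2 (\row_j x 0 (lift ord0 j)).
Proof.
rewrite /dotp big_ord_recl !mxE unlift_none mulrC; congr (_ + _).
by apply: eq_bigr => j _; rewrite !mxE liftK.
Qed.

End cons_row.

(** A frequency vector with independent coordinates of law [mu]. The sine
    integral is carried along because the addition formula for cos needs it in
    the inductive step. *)
Lemma product_law (R : realType) (mu : probability R R) (d : nat) :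
  (forall u, \int[mu]_z sin (u * z) = 0) ->
  exists nu : probability 'rV[R]_d R, forall x,
    \int[nu]_t cos (dotp t x) = \prod_j \int[mu]_z cos (x 0 j * z) /\
    \int[nu]_t sin (dotp t x) = 0.
Proof.
move=> mu_sin; elim: d => [|d [nu nuE]].
  exists (dirac (0 : 'rV[R]_0)) => x; split.
    rewrite big_ord0 -(expectation_constant (dirac (0 : 'rV[R]_0)) 1).
    by apply: eq_Rintegral => t _; rewrite /dotp big_ord0 cos0.
  rewrite -(expectation_constant (dirac (0 : 'rV[R]_0)) 0).
  by apply: eq_Rintegral => t _; rewrite /dotp big_ord0 sin0.
exists (distribution (mu \x nu)%E (@cons_row R d)) => x.
set x' := \row_j x 0 (lift ord0 j).
have mx : measurable_fun [set: 'rV[R]_d.+1] (fun t => dotp t x).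
  exact: measurable_fun_dotp.
have mx' : measurable_fun [set: 'rV[R]_d] (fun t => dotp t x').
  exact: measurable_fun_dotp.
have mu_u : measurable_fun [set: R] (fun z => x 0 ord0 * z).
  exact: measurable_funM.
have [ct st] := (bounded_measurable_cos mx', bounded_measurable_sin mx').
have [cz sz] := (bounded_measurable_cos mu_u, bounded_measurable_sin mu_u).
have bk (h : 'rV[R]_d -> R) c : bounded_measurable h ->
    bounded_measurable (fun t => c * h t).
  move=> bh; exact: bounded_measurableM (bounded_measurable_cst _) _.
have consE z t : dotp (cons_row (z, t)) x = x 0 ord0 * z + dotp t x'.
  exact: dotp_cons_row.
have [nuc nus] := nuE x'.
have mcons := @measurable_funPT _ _ _ _ (@cons_row R d).
split.
  rewrite expectation_distribution; last exact: bounded_measurable_cos.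
  rewrite expectation_product; last first.
    exact: bounded_measurable_comp (bounded_measurable_cos mx) mcons.
  rewrite big_ord_recl mulrC -expectation_scale//; apply: eq_Rintegral => z _.
  under eq_Rintegral do rewrite consE cosD.
  rewrite expectation_sub; [|exact: bk..].
  rewrite !expectation_scale// nus mulr0 subr0 nuc mulrC; congr (_ * _).
  by apply: eq_bigr => j _; apply: eq_Rintegral => w _; rewrite mxE.
rewrite expectation_distribution; last exact: bounded_measurable_sin.
rewrite expectation_product; last first.
  exact: bounded_measurable_comp (bounded_measurable_sin mx) mcons.
transitivity (\int[mu]_z
    ((\int[nu]_t cos (dotp t x')) * sin (x 0 ord0 * z))); last first.
  by rewrite expectation_scale// mu_sin mulr0.
apply: eq_Rintegral => z _.
under eq_Rintegral do rewrite consE sinD.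
rewrite expectation_add; [|exact: bk..].
by rewrite !expectation_scale// nus mulr0 addr0 mulrC.
Qed.

Section fejer_kernel.
Context (R : realType) (d : nat).

Definition fejer_kernel (x : 'rV[R]_d) : R := \prod_j fejer (x 0 j).

Lemma fejer_law_product : exists nu : probability 'rV[R]_d R,
  forall x, \int[nu]_t cos (dotp t x) = fejer_kernel x.
Proof.
have [nu nuE] := @product_law R (fejer_law R) d (@difference_law_sin _ _).
by exists nu => x; have [] := nuE x.
Qed.

End fejer_kernel.

(** * Independent sums *)

(** The layer-cake formula for a number of [0, 1]. *)
Lemma expectation_uniform_indicator (R : realType) (v : R) : 0 <= v <= 1 ->
  \int[uniform_law R]_s \1_[set s | s < v] s = v.
Proof.
move=> /andP[v0 v1].
have mv : measurable [set s : R | s < v] by exact: measurable_itv `]-oo, v[.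
rewrite expectation_uniform; last 2 first.
- exact: measurable_indic.
- by move=> x; rewrite indicE.
rewrite /Rintegral integral_indic//=.
have -> : [set s : R | s < v] `&` `[0, 1] = `[0, v[%classic.
  apply/seteqP; split=> x /=; rewrite !in_itv/=.
    by move=> [xv /andP[x0 _]]; rewrite x0.
  by move=> /andP[x0 xv]; split=> //; rewrite x0 (le_trans (ltW xv)).
rewrite lebesgue_measure_itv/= lte_fin oppr0 adde0.
by case: ltP => //= v0'; apply/le_anti; rewrite v0 v0'.
Qed.

Section decouple.
Context disp (T : measurableType disp) (R : realType) (P : probability T R).
Variables (Y : {RV P >-> R}) (g : T -> R) (c : R).
Hypothesis bg : bounded_measurable g.
Hypothesis Yg : forall A : set R, measurable A ->
  \int[P]_w (\1_A (Y w) * g w) = c * \int[P]_w \1_A (Y w).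

Let mY : measurable_fun [set: T] Y.
Proof. exact: measurable_funPT. Qed.

(* By the layer-cake formula, F (Y w) is the average over s of the indicator of
   s < F (Y w), to which [Yg] applies. *)
Let decouple01 (F : R -> R) : measurable_fun [set: R] F ->
  (forall y, 0 <= F y <= 1) ->
  \int[P]_w (F (Y w) * g w) = c * \int[P]_w F (Y w).
Proof.
move=> mF F01.
pose D : set (T * R) := [set p | p.2 < F (Y p.1)].
have mD : measurable D.
  rewrite -[D]setTI; apply: measurable_fun_ltr => //.
  by apply: measurableT_comp => //; apply: measurableT_comp.
have bD := @bounded_measurable_indic _ _ R _ mD.
have bDg : bounded_measurable (fun p => \1_D p * g p.1).
  by apply: bounded_measurableM => //; exact: bounded_measurable_comp bg _.
have FE w : F (Y w) = \int[uniform_law R]_s \1_D (w, s).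
  by rewrite -[LHS]expectation_uniform_indicator.
have bDs w : bounded_measurable (fun s => \1_D (w, s) : R).
  by apply: (bounded_measurable_comp bD); exact: pair1_measurable.
transitivity (\int[P]_w \int[uniform_law R]_s (\1_D (w, s) * g w)).
  apply: eq_Rintegral => w _; rewrite mulrC FE -expectation_scale//.
  by apply: eq_Rintegral => s _; rewrite mulrC.
rewrite (expectation_fubini _ _ bDg).
have YgD s : \int[P]_w (\1_D (w, s) * g w) = c * \int[P]_w \1_D (w, s).
  apply: (Yg (A := [set y | s < F y])).
  by rewrite -[X in measurable X]setTI; exact: measurable_fun_ltr.
under eq_Rintegral do rewrite YgD.
rewrite expectation_scale; last first.
  exact: (bounded_measurable_fubini2 _ (uniform_law R) bD).
congr (_ * _); rewrite -(expectation_fubini P (uniform_law R) bD).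
by apply: eq_Rintegral => w _; rewrite FE.
Qed.

(** If [g] is uncorrelated with every event of [Y], then it is uncorrelated with
    every bounded function of [Y]. *)
Lemma decouple (f : R -> R) : bounded_measurable f ->
  \int[P]_w (f (Y w) * g w) = c * \int[P]_w f (Y w).
Proof.
move=> bf; have [mf [M0 fM0]] := bf; pose M := M0 + 1.
have M_gt0 : 0 < M.
  by rewrite ltr_wpDl// (le_trans (normr_ge0 _) (fM0 0)).
have fM y : `|f y| <= M by rewrite (le_trans (fM0 y))// lerDl.
pose F y := (f y + M) / (2 * M).
have FE y : f y = 2 * M * F y - M by rewrite /F; field; exact: lt0r_neq0.
have F01 y : 0 <= F y <= 1.
  have := fM y; rewrite ler_norml => /andP[fyl fyr].
  rewrite /F divr_ge0/= ?ler_pdivrMr; lra.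
have bF : bounded_measurable F.
  exact: bounded_measurableM (bounded_measurableD bf (bounded_measurable_cst M))
    (bounded_measurable_cst _).
have bFY := bounded_measurable_comp bF mY.
have bk := @bounded_measurable_cst _ T R.
have bFg := bounded_measurableM bFY bg.
have fgE w : f (Y w) * g w = 2 * M * (F (Y w) * g w) - M * g w.
  by rewrite FE; ring.
under eq_Rintegral do rewrite fgE.
rewrite (expectation_sub _ (bounded_measurableM (bk _) bFg)
  (bounded_measurableM (bk _) bg)).
rewrite !expectation_scale//.
rewrite decouple01//; last by case: bF.
have -> : \int[P]_w g w = c.
  have := Yg measurableT.
  under eq_Rintegral do rewrite indicT mul1r.
  by move=> ->; under eq_Rintegral do rewrite indicT; rewrite expectation_constant mulr1.
under [in RHS]eq_Rintegral do rewrite FE.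
rewrite (expectation_sub _ (bounded_measurableM (bk _) bFY) (bk _)).
by rewrite expectation_scale// expectation_constant; ring.
Qed.

End decouple.

Section independent_sums.
Context disp (T : measurableType disp) (R : realType) (P : probability T R).
Context (I : finType) (X : I -> {RV P >-> R}) (u : I -> R).
Hypothesis indX : mutually_independent X.

Let mX i : measurable_fun [set: T] (X i).
Proof. exact: measurable_funPT. Qed.

Let event (J : {set I}) (A : I -> set R) : set T :=
  \bigcap_(i in [set` J]) (X i @^-1` A i).

Let measurable_event J A : (forall i, measurable (A i)) ->
  measurable (event J A).
Proof.
move=> mA; apply: fin_bigcap_measurable => // i _.
by rewrite -[X in measurable X]setTI; exact: mX.
Qed.

Let phase (s : seq I) (th : R) (w : T) : R := \sum_(i <- s) u i * X i w + th.

Let measurable_phase s th : measurable_fun [set: T] (phase s th).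
Proof.
apply: measurable_funD => //; apply: measurable_sum => i.
exact: measurable_funM.
Qed.

Let bounded_cos_phase s th : bounded_measurable (fun w => cos (phase s th w)).
Proof. exact: bounded_measurable_cos. Qed.

Let event_consE (k : I) (J : {set I}) (A : I -> set R) (B : set R) w :
  k \notin J ->
  \1_B (X k w) * \1_(event J A) w =
  \1_(event (k |: J) (fun i => if i == k then B else A i)) w :> R.
Proof.
move=> kJ; rewrite !indicE -natrM mulnb; congr (_%:R); congr nat_of_bool.
apply/idP/idP.
  move=> /andP[/set_mem Bk /set_mem EJ]; apply/mem_set => i /=.
  rewrite !inE => /orP[/eqP ->|iJ]; first by rewrite eqxx.
  have -> : (i == k) = false by apply: contraNF kJ => /eqP <-.
  exact: EJ.
move=> /set_mem EJ; apply/andP; split; apply/mem_set.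
  by have := EJ k; rewrite /= eqxx; apply; rewrite /= !inE eqxx.
move=> i /= iJ; have := EJ i; rewrite /= !inE iJ orbT.
have -> : (i == k) = false by apply: contraNF kJ => /eqP <-.
exact.
Qed.

Let event_cons_prob (k : I) (J : {set I}) (A : I -> set R) (B : set R) :
  k \notin J -> measurable B -> (forall i, measurable (A i)) ->
  P (event (k |: J) (fun i => if i == k then B else A i)) =
  (P (X k @^-1` B) * P (event J A))%E.
Proof.
move=> kJ mB mA; rewrite /event !indX//; last by move=> i; case: ifP.
rewrite big_setU1//= eqxx; congr (_ * _)%E.
apply: eq_bigr => i iJ.
by have -> : (i == k) = false by apply: contraNF kJ => /eqP <-.
Qed.

(* The trigonometric function of a partial sum is uncorrelated with every event
   of the remaining variables. The phase [th] is free so that the same property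
   gives the sine, and the property passes from [s] to [k :: s] because events
   of X k may be added to [J]. *)
Let factors (s : seq I) := forall (J : {set I}) (A : I -> set R) (th : R),
  (forall i, measurable (A i)) -> (forall i, i \in s -> i \notin J) ->
  \int[P]_w (\1_(event J A) w * cos (phase s th w)) =
  fine (P (event J A)) * \int[P]_w cos (phase s th w).

Let factors_step (k : I) (s : seq I) : factors s ->
  forall (J : {set I}) (A : I -> set R) (th : R) (f : R -> R),
    (forall i, measurable (A i)) -> (forall i, i \in s -> i \notin J) ->
    k \notin s -> k \notin J -> bounded_measurable f ->
  \int[P]_w (f (X k w) * (\1_(event J A) w * cos (phase s th w))) =
  fine (P (event J A)) * \int[P]_w cos (phase s th w) * \int[P]_w f (X k w).
Proof.
move=> IHs J A th f mA sJ ks kJ bf.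
have mE := measurable_event J mA.
apply: decouple => // [|B mB].
  exact: bounded_measurableM (bounded_measurable_indic mE) _.
have mXB : measurable (X k @^-1` B).
  by rewrite -[X in measurable X]setTI; exact: mX.
under eq_Rintegral do rewrite mulrA event_consE//.
rewrite IHs; last 2 first.
- by move=> i; case: ifP.
- move=> i si; rewrite !inE negb_or sJ// andbT.
  by apply: contraNneq ks => <-.
rewrite event_cons_prob// fineM ?fin_num_measure//.
have -> : \int[P]_w \1_B (X k w) = fine (P (X k @^-1` B)).
  exact: (expectation_indicator P mXB).
by ring.
Qed.

Let phase_cons k s th w : phase (k :: s) th w = u k * X k w + phase s th w.
Proof. by rewrite /phase big_cons addrA. Qed.

Let sin_phase s th w : sin (phase s th w) = cos (phase s (th - pi / 2) w).
Proof. by rewrite /phase addrA cosBpihalf. Qed.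

Let factors_expand (k : I) (s : seq I) : factors s ->
  forall (J : {set I}) (A : I -> set R) (th : R),
    (forall i, measurable (A i)) -> (forall i, i \in s -> i \notin J) ->
    k \notin s -> k \notin J ->
  \int[P]_w (\1_(event J A) w * cos (phase (k :: s) th w)) =
  fine (P (event J A)) *
    ((\int[P]_w cos (u k * X k w)) * (\int[P]_w cos (phase s th w)) -
     (\int[P]_w sin (u k * X k w)) * (\int[P]_w sin (phase s th w))).
Proof.
move=> Fs J A th mA sJ ks kJ.
have mu : measurable_fun [set: R] (fun x => u k * x) by exact: measurable_funM.
have bE := @bounded_measurable_indic _ _ R _ (measurable_event J mA).
have bc th' := bounded_measurableM
  (bounded_measurable_comp (bounded_measurable_cos mu) (mX k))
  (bounded_measurableM bE (bounded_cos_phase s th')).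
have bs th' := bounded_measurableM
  (bounded_measurable_comp (bounded_measurable_sin mu) (mX k))
  (bounded_measurableM bE (bounded_cos_phase s th')).
transitivity (\int[P]_w
  (cos (u k * X k w) * (\1_(event J A) w * cos (phase s th w)) -
   sin (u k * X k w) * (\1_(event J A) w * cos (phase s (th - pi / 2) w)))).
  by apply: eq_Rintegral => w _; rewrite phase_cons cosD -sin_phase; ring.
rewrite (expectation_sub _ (bc th) (bs _)).
rewrite (factors_step Fs _ mA sJ ks kJ (bounded_measurable_cos mu)).
rewrite (factors_step Fs _ mA sJ ks kJ (bounded_measurable_sin mu)).
have -> : \int[P]_w sin (phase s th w) =
    \int[P]_w cos (phase s (th - pi / 2) w).
  by apply: eq_Rintegral => w _; exact: sin_phase.
by ring.
Qed.

Let event0 (A : I -> set R) : event (@finset.set0 I) A = setT.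
Proof. by apply/seteqP; split=> // w _ i; rewrite /= inE. Qed.

Let factors_sum_cos k s th : factors s -> k \notin s ->
  \int[P]_w cos (phase (k :: s) th w) =
    (\int[P]_w cos (u k * X k w)) * (\int[P]_w cos (phase s th w)) -
    (\int[P]_w sin (u k * X k w)) * (\int[P]_w sin (phase s th w)).
Proof.
move=> Fs ks.
have := @factors_expand k s Fs (@finset.set0 I) (fun=> setT) th.
rewrite event0 probability_setT mul1r => <- //; last 2 first.
- by move=> i _; rewrite inE.
- by rewrite inE.
by apply: eq_Rintegral => w _; rewrite indicT mul1r.
Qed.

Let factors_uniq (s : seq I) : uniq s -> factors s.
Proof.
elim: s => [|k s IHs]/=.
  move=> _ J A th mA _.
  have mE := measurable_event J mA.
  transitivity (\int[P]_w (cos th * \1_(event J A) w)).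
    by apply: eq_Rintegral => w _; rewrite /phase big_nil add0r mulrC.
  rewrite expectation_scale; last exact: bounded_measurable_indic.
  rewrite expectation_indicator// mulrC; congr (_ * _).
  under eq_Rintegral do rewrite /phase big_nil add0r.
  by rewrite expectation_constant.
move=> /andP[ks us] J A th mA ksJ; have Fs := IHs us.
rewrite (factors_expand Fs)//; last 2 first.
- by move=> i si; apply: ksJ; rewrite inE si orbT.
- by apply: ksJ; rewrite inE eqxx.
by rewrite factors_sum_cos.
Qed.

Lemma independent_sum_cos k s th : uniq (k :: s) ->
  \int[P]_w cos (\sum_(i <- k :: s) u i * X i w + th) =
    (\int[P]_w cos (u k * X k w)) *
      (\int[P]_w cos (\sum_(i <- s) u i * X i w + th)) -
    (\int[P]_w sin (u k * X k w)) *
      (\int[P]_w sin (\sum_(i <- s) u i * X i w + th)).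
Proof.
by move=> /= /andP[ks us]; exact: factors_sum_cos (factors_uniq us) ks.
Qed.

(** The squared modulus of the characteristic function of a sum of independent
    variables is the product of those of the summands: this is the
    multiplicativity of the modulus of complex numbers applied to the addition
    formulas. *)
Lemma independent_sum_char_fun_sqr (s : seq I) : uniq s ->
  (\int[P]_w cos (\sum_(i <- s) u i * X i w)) ^+ 2 +
  (\int[P]_w sin (\sum_(i <- s) u i * X i w)) ^+ 2 =
  \prod_(i <- s) ((\int[P]_w cos (u i * X i w)) ^+ 2 +
                  (\int[P]_w sin (u i * X i w)) ^+ 2).
Proof.
elim: s => [|k s IHs] /=.
  move=> _; rewrite big_nil; under eq_Rintegral do rewrite big_nil cos0.
  under [in X in _ + X]eq_Rintegral do rewrite big_nil sin0.
  by rewrite !expectation_constant expr1n expr0n addr0.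
move=> us; have /andP[_ /IHs {}IHs] := us.
pose S (s : seq I) w := \sum_(i <- s) u i * X i w.
have mS t : measurable_fun [set: T] (S t).
  by apply: measurable_sum => i; exact: measurable_funM.
have := independent_sum_cos 0 us; rewrite -!/(S _ _).
have := independent_sum_cos (- (pi / 2)) us; rewrite -!/(S _ _).
have cos0E t : \int[P]_w cos (S t w + 0) = \int[P]_w cos (S t w).
  by apply: eq_Rintegral => w _; rewrite addr0.
have sin0E t : \int[P]_w sin (S t w + 0) = \int[P]_w sin (S t w).
  by apply: eq_Rintegral => w _; rewrite addr0.
have cospE t : \int[P]_w cos (S t w - pi / 2) = \int[P]_w sin (S t w).
  by apply: eq_Rintegral => w _; rewrite cosBpihalf.
have sinpE t : \int[P]_w sin (S t w - pi / 2) = - \int[P]_w cos (S t w).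
  rewrite -[RHS]mulN1r -expectation_scale; last exact: bounded_measurable_cos.
  by apply: eq_Rintegral => w _; rewrite sinBpihalf mulN1r.
rewrite -/(S (k :: s)) -/(S s) !cos0E sin0E !cospE sinpE => -> ->.
rewrite big_cons -IHs -/(S s).
by ring.
Qed.

End independent_sums.

(** * The characteristic function of the weighted sum *)

Section characteristic_function_bound.
Context disp (T : measurableType disp) (R : realType) (P : probability T R).

Lemma expectation_identically_distributed (X Y : {RV P >-> R}) (f : R -> R) :
  (forall A : set R, measurable A -> distribution P X A = distribution P Y A) ->
  bounded_measurable f -> \int[P]_w f (X w) = \int[P]_w f (Y w).
Proof.
move=> XY bf; rewrite -!expectation_distribution// /Rintegral; congr fine.
by apply: eq_measure_integral => A mA _; exact: XY.
Qed.

(** The real part of exp (- i th) times a complex number is at most its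
    modulus. *)
Lemma expectation_cos_shift (f : T -> R) (th : R) :
  measurable_fun [set: T] f ->
  \int[P]_w cos (f w - th) <= Num.sqrt ((\int[P]_w cos (f w)) ^+ 2 +
    (\int[P]_w sin (f w)) ^+ 2).
Proof.
move=> mf; have bc := bounded_measurable_cos mf.
have bs := bounded_measurable_sin mf.
have bk := @bounded_measurable_cst _ T R.
have -> : \int[P]_w cos (f w - th) =
    cos th * (\int[P]_w cos (f w)) + sin th * (\int[P]_w sin (f w)).
  rewrite -!expectation_scale//.
  rewrite -(expectation_add _ (bounded_measurableM (bk _) bc)
    (bounded_measurableM (bk _) bs)).
  by apply: eq_Rintegral => w _; rewrite cosB mulrC [X in _ + X]mulrC.
set c := \int[P]_w _; set s := \int[P]_w _.
apply: le_trans (ler_norm _) _; rewrite -sqrtr_sqr ler_sqrt; last first.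
  by rewrite addr_ge0// sqr_ge0.
have := cos2Dsin2 th; have := sqr_ge0 (cos th * s - sin th * c).
set ct := cos th; set st := sin th => h1 h2.
rewrite -subr_ge0 (_ : _ - _ = (ct * s - st * c) ^+ 2) ?sqr_ge0//.
transitivity ((ct ^+ 2 + st ^+ 2) * (c ^+ 2 + s ^+ 2) -
  (ct * c + st * s) ^+ 2); last by ring.
by rewrite h2 mul1r.
Qed.

(** The squared modulus of the characteristic function of X at u is the
    characteristic function g of the symmetrized law at u, and
    g <= exp (g - 1). *)
Lemma weighted_sum_cos_le n d (X : {RV P >-> R}) (Xs : 'I_n -> {RV P >-> R})
    (a : 'I_n -> 'rV[R]_d) (t : 'rV[R]_d) (th : R) :
  iid (fun k : option 'I_n => if k is Some i then Xs i else X) ->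
  \int[P]_w cos (dotp t (weighted_sum Xs a w) - th) <=
  expR (- 2^-1 * \sum_k
    (1 - \int[symmetrized_distribution X]_z cos (dotp t (a k) * z))).
Proof.
move=> [indX idX].
set g := fun u => \int[symmetrized_distribution X]_z cos (u * z).
have mu u : measurable_fun [set: R] (fun x : R => u * x).
  exact: measurable_funM.
have gE k u : (\int[P]_w cos (u * Xs k w)) ^+ 2 +
    (\int[P]_w sin (u * Xs k w)) ^+ 2 = g u.
  rewrite /g [RHS](difference_law_cos (distribution P X)).
  rewrite !expectation_distribution;
    [|exact: bounded_measurable_sin|exact: bounded_measurable_cos].
  have XkX A : measurable A -> distribution P (Xs k) A = distribution P X A.
    exact: (idX (Some k) None).
  by congr (_ ^+ 2 + _ ^+ 2);
    apply: (expectation_identically_distributed XkX (f := fun x => _ (u * x)));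
    [exact: bounded_measurable_cos|exact: bounded_measurable_sin].
have mdot : measurable_fun [set: T] (fun w => dotp t (weighted_sum Xs a w)).
  by apply: measurable_fun_dotp => //; exact: measurable_funPT.
apply: le_trans (expectation_cos_shift th mdot) _.
pose u (k : option 'I_n) := if k is Some i then dotp t (a i) else 0.
have sumE w : dotp t (weighted_sum Xs a w) =
    \sum_(k <- map some (enum 'I_n))
      u k * (if k is Some i then Xs i else X) w.
  rewrite big_map big_enum /weighted_sum dotp_sumr; apply: eq_bigr => k _.
  by rewrite dotpZr mulrC.
have us : uniq (map some (enum 'I_n)).
  by rewrite map_inj_uniq ?enum_uniq// => i j [].
have := independent_sum_char_fun_sqr u indX us.
under eq_Rintegral do rewrite -sumE.
under [in X in _ + X]eq_Rintegral do rewrite -sumE.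
move=> ->; rewrite big_map big_enum.
rewrite -(@ger0_norm _ (expR _)) ?expR_ge0// -sqrtr_sqr ler_sqrt ?sqr_ge0//.
rewrite -expRM_natl (_ : _ * _ = - \sum_k (1 - g (dotp t (a k)))); last first.
  by rewrite -/g; field.
rewrite -sumrN expR_sum; apply: ler_prod => k _ /=.
rewrite addr_ge0 ?sqr_ge0//= gE -/(g _) opprB.
have := expR_ge1Dx (g (u (Some k)) - 1); rewrite addrCA subrr addr0 /u.
exact: le_trans.
Qed.

End characteristic_function_bound.

(** Jensen's inequality for exp and the probability measure of density [w]
    divided by its integral [lam]. Replacing G by the smaller measure of density
    [w] only increases the left-hand side. The proof integrates the tangent line
    of exp at the mean [m]. *)
Lemma expR_expectation_le (R : realType) (G : probability R R) (w h : R -> R) :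
  bounded_measurable w -> bounded_measurable h ->
  (forall z, 0 <= w z <= 1) -> (forall z, 0 <= h z) ->
  0 < \int[G]_z w z ->
  expR (- \int[G]_z h z) <=
  (\int[G]_z w z)^-1 * \int[G]_z (w z * expR (- (\int[G]_z w z * h z))).
Proof.
move=> bw bh w01 h0; set lam := \int[G]_z w z => lam0.
set m := lam^-1 * \int[G]_z (w z * h z).
have bwh := bounded_measurableM bw bh.
have bk := @bounded_measurable_cst _ R R.
have bexp : bounded_measurable (fun z => expR (- (lam * h z))).
  apply: bounded_measurable_expRN => [|z]; last by rewrite mulr_ge0// ltW.
  by apply: measurable_funM => //; case: bh.
rewrite ler_pdivlMl//.
apply: (@le_trans _ _ (lam * expR (- (lam * m)))).
  rewrite ler_pM2l// ler_expR lerN2 /m mulVKf ?gt_eqF//.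
  apply: expectation_mono => // z.
  by have /andP[w0 w1] := w01 z; rewrite ler_piMl.
apply: (@le_trans _ _ (\int[G]_z
    (expR (- (lam * m)) * (1 + lam * m) * w z -
     expR (- (lam * m)) * lam * (w z * h z)))).
  rewrite (expectation_sub _ (bounded_measurableM (bk _) bw)
    (bounded_measurableM (bk _) bwh)) !expectation_scale// -/lam.
  have -> : \int[G]_z (w z * h z) = lam * m by rewrite /m mulVKf ?gt_eqF.
  by rewrite le_eqVlt; apply/orP; left; apply/eqP; ring.
apply: expectation_mono.
- exact: bounded_measurableB (bounded_measurableM (bk _) bw)
    (bounded_measurableM (bk _) bwh).
- exact: bounded_measurableM.
move=> z; have /andP[w0 _] := w01 z.
have -> : expR (- (lam * h z)) = expR (- (lam * m)) * expR (lam * m - lam * h z).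
  by rewrite -expRD; congr expR; ring.
have := expR_ge1Dx (lam * m - lam * h z).
have := expR_ge0 (- (lam * m)).
set E1 := expR _; set E2 := expR _ => E10 E2le.
rewrite -subr_ge0.
have -> : w z * (E1 * E2) - (E1 * (1 + lam * m) * w z - E1 * lam * (w z * h z)) =
  (w z * E1) * (E2 - (1 + (lam * m - lam * h z))) by ring.
by rewrite mulr_ge0 ?mulr_ge0// subr_ge0.
Qed.

(** * Smoothed probabilities are bounded by box probabilities *)

Section fejer_cells.
Variables (R : realType) (delta : R).
Hypothesis delta01 : 0 < delta <= 1.

Let delta_gt0 : 0 < delta. Proof. by case/andP: delta01. Qed.

(** A telescoping upper bound of [fejer] on the j-th cell of length [delta]; with
    x = j * delta it equals 12 / ((1 + x) (1 + x + delta)). *)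
Definition cell_weight (j : nat) : R :=
  12 / delta * ((1 + j%:R * delta)^-1 - (1 + j.+1%:R * delta)^-1).

Let cell_pos j : 0 < 1 + j%:R * delta.
Proof. by rewrite ltr_pwDl// mulr_ge0// ltW. Qed.

Lemma fejer_le_cell_weight j (v : R) :
  j%:R * delta <= `|v| -> fejer v <= cell_weight j.
Proof.
have /andP[d0 d1] := delta01.
set x := j%:R * delta => xv.
have x0 : 0 <= x by rewrite mulr_ge0// ltW.
have -> : cell_weight j = 12 / ((1 + x) * (1 + x + delta)).
  have -> : cell_weight j = 12 / delta * ((1 + x)^-1 - (1 + (x + delta))^-1).
    have e : j.+1%:R * delta = x + delta by rewrite -natr1 mulrDl mul1r.
    by rewrite /cell_weight e.
  by field; rewrite !gt_eqF//; lra.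
have den : 0 < (1 + x) * (1 + x + delta) by nra.
rewrite ler_pdivlMr//.
have [x2|x2] := leP x 2.
  apply: (@le_trans _ _ (1 * ((1 + x) * (1 + x + delta)))).
    by rewrite ler_wpM2r ?fejer_le1// ltW.
  by nra.
have v0 : v != 0 by rewrite -normr_gt0; lra.
have v2 : x ^+ 2 <= v ^+ 2.
  by rewrite -(real_normK (num_real v)) lerXn2r ?nnegrE.
apply: (@le_trans _ _ (4 / x ^+ 2 * ((1 + x) * (1 + x + delta)))).
  rewrite ler_wpM2r ?(ltW den)// (le_trans (fejer_le_inv_sqr v0))//.
  by rewrite ler_pM2l// lef_pV2// posrE exprn_even_gt0//=; lra.
rewrite -mulrA mulrCA ler_pdivrMl; last by nra.
by nra.
Qed.

Lemma cell_weight_ge0 j : 0 <= cell_weight j.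
Proof.
apply: le_trans (fejer_ge0 (j%:R * delta)) _; apply: fejer_le_cell_weight.
exact: ler_norm.
Qed.

Lemma sum_cell_weight n : \sum_(0 <= j < n) cell_weight j <= 12 / delta.
Proof.
rewrite (@telescope_sumr_eq _ 0 n
  (fun j => - (12 / delta * (1 + j%:R * delta)^-1)))//.
  rewrite mul0r addr0 invr1 mulr1 opprK gerDr oppr_le0.
  by rewrite mulr_ge0 ?invr_ge0 ?divr_ge0 ?ltW.
by move=> j _; rewrite /cell_weight; ring.
Qed.

Context {disp : measure_display} {T : measurableType disp}.
Variable P : probability T R.

(** The half-line is cut into cells of length [delta], on each of which [fejer]
    is at most its cell weight; the weights sum to at most 12 / delta. *)
Lemma integral_cells (D : set T) (v : T -> R) (g : T -> R) (K : R) :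
  measurable D -> measurable_fun [set: T] v -> measurable_fun [set: T] g ->
  (forall w, 0 <= g w) -> (forall w, D w -> 0 <= v w) ->
  (forall j : nat, (\int[P]_(w in D `&`
      [set w | (j%:R * delta <= v w < j.+1%:R * delta)%R]) (g w)%:E <= K%:E)%E) ->
  (\int[P]_(w in D) (fejer (v w) * g w)%:E <= (12 / delta * K)%:E)%E.
Proof.
move=> mD mv mg g0 v0 cellK.
pose C j := D `&` [set w | j%:R * delta <= v w < j.+1%:R * delta].
have mC j : measurable (C j).
  apply: measurableI => //.
  rewrite (_ : [set w | _] = v @^-1` `[j%:R * delta, j.+1%:R * delta[%classic).
    by rewrite -[X in measurable X]setTI; exact: mv.
  by apply/seteqP; split=> w /=; rewrite in_itv.
have CU : \bigcup_j C j = D.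
  apply/seteqP; split=> [w [j _ []]//|w Dw].
  exists (Num.truncn (v w / delta)) => //; split=> //=.
  have /truncn_itv : 0 <= v w / delta by rewrite divr_ge0 ?v0// ltW.
  by rewrite ler_pdivlMr// ltr_pdivrMr.
have tC : trivIset setT C.
  move=> i j _ _ [w [[Dw /= Ci] [_ /= Cj]]].
  have cell k : k%:R * delta <= v w < k.+1%:R * delta ->
      Num.truncn (v w / delta) = k.
    by move=> kv; apply: truncn_def; rewrite ler_pdivlMr// ltr_pdivrMr.
  by rewrite -(cell _ Ci) -(cell _ Cj).
have mf : measurable_fun [set: T] (fun w => (fejer (v w) * g w)%:E).
  apply/measurable_EFinP; apply: measurable_funM => //.
  exact: measurableT_comp (@measurable_fejer R) _.
have K0 : 0 <= K.
  rewrite -lee_fin (le_trans _ (cellK 0%N))//.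
  by apply: integral_ge0 => w _; rewrite lee_fin.
rewrite -CU ge0_integral_bigcup//; last 2 first.
- exact: measurable_funTS.
- by move=> w _; rewrite lee_fin mulr_ge0// fejer_ge0.
apply: (@le_trans _ _ (\sum_(j <oo) (cell_weight j * K)%:E)%E).
  apply: lee_nneseries => [j _ _|j _].
    by apply: integral_ge0 => w _; rewrite lee_fin mulr_ge0// fejer_ge0.
  apply: (@le_trans _ _ (\int[P]_(w in C j) ((cell_weight j)%:E * (g w)%:E))%E).
    apply: ge0_le_integral => //.
    - by move=> w _; rewrite lee_fin mulr_ge0// fejer_ge0.
    - exact: measurable_funTS.
    - apply: measurable_funTS; apply/measurable_EFinP.
      by apply: measurable_funM.
    - move=> w [Dw /= /andP[jv _]]; rewrite -EFinM lee_fin ler_wpM2r//.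
      by apply: fejer_le_cell_weight; rewrite (le_trans jv)// ler_norm.
  rewrite ge0_integralZl_EFin//; last 3 first.
  - by move=> w _; rewrite lee_fin.
  - by apply: measurable_funTS; apply/measurable_EFinP.
  - exact: cell_weight_ge0.
  by rewrite (EFinM (cell_weight j) K) lee_wpmul2l ?cellK// lee_fin cell_weight_ge0.
apply: lime_le.
  by apply: is_cvg_nneseries => j _ _; rewrite lee_fin mulr_ge0// cell_weight_ge0.
apply: nearW => n; rewrite sumEFin lee_fin -mulr_suml.
by rewrite ler_wpM2r// sum_cell_weight.
Qed.

Lemma integral_cells_twosided (D : set T) (v : T -> R) (g : T -> R) (K : R) :
  measurable D -> measurable_fun [set: T] v -> measurable_fun [set: T] g ->
  (forall w, 0 <= g w) ->
  (forall x : R, (\int[P]_(w in D `&` [set w | (x <= v w <= x + delta)%R])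
      (g w)%:E <= K%:E)%E) ->
  (\int[P]_(w in D) (fejer (v w) * g w)%:E <= (24 / delta * K)%:E)%E.
Proof.
move=> mD mv mg g0 cellK.
have succE (j : nat) : j.+1%:R * delta = j%:R * delta + delta.
  by rewrite -natr1 mulrDl mul1r.
have mpre (B : set R) : measurable B -> measurable (v @^-1` B).
  by move=> mB; rewrite -[X in measurable X]setTI; exact: mv.
have subcell (E : set T) x : measurable E ->
    E `<=` D `&` [set w | x <= v w <= x + delta] ->
    (\int[P]_(w in E) (g w)%:E <= K%:E)%E.
  move=> mE Ex; apply: le_trans (cellK x); apply: ge0_subset_integral => //.
  - apply: measurableI => //; rewrite (_ : [set w | _] =
      v @^-1` `[x, x + delta]%classic); first exact: mpre.
    by apply/seteqP; split=> w /=; rewrite in_itv.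
  - by apply: measurable_funTS; apply/measurable_EFinP.
  - by move=> w _; rewrite lee_fin.
pose Dp := D `&` v @^-1` `[0, +oo[; pose Dn := D `&` v @^-1` `]-oo, 0[.
have mDp : measurable Dp by apply: measurableI => //; exact: mpre.
have mDn : measurable Dn by apply: measurableI => //; exact: mpre.
have DE : D = Dp `|` Dn.
  apply/seteqP; split=> [w Dw|w [[]|[]]//].
  by have [v0|v0] := leP 0 (v w); [left|right]; split; rewrite //= in_itv/= ?andbT.
have mf : measurable_fun [set: T] (fun w => (fejer (v w) * g w)%:E).
  apply/measurable_EFinP; apply: measurable_funM => //.
  exact: measurableT_comp (@measurable_fejer R) _.
rewrite DE ge0_integral_setU//; last 3 first.
- exact: measurable_funTS.
- by move=> w _; rewrite lee_fin mulr_ge0// fejer_ge0.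
- rewrite disj_set2E; apply/eqP; apply/seteqP; split=> // w [[_ /=] + [_ /=]].
  by rewrite !in_itv/= andbT => v0; rewrite ltNge v0.
have -> : 24 / delta * K = 12 / delta * K + 12 / delta * K.
  by field; rewrite gt_eqF.
rewrite EFinD leeD//.
  apply: integral_cells => //.
    by move=> w [_ /=]; rewrite in_itv/= andbT.
  move=> j; apply: (subcell _ (j%:R * delta)).
    apply: measurableI => //; rewrite (_ : [set w | _] =
      v @^-1` `[j%:R * delta, j.+1%:R * delta[%classic); first exact: mpre.
    by apply/seteqP; split=> w /=; rewrite in_itv.
  by move=> w [[Dw _] /= /andP[jv /ltW vj]]; split=> //=; rewrite jv -succE.
under eq_integral do rewrite -fejerN.
apply: (integral_cells (v := fun w => - v w)) => //.
- exact: measurable_funN.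
- by move=> w [_ /=]; rewrite in_itv/= oppr_ge0 => /ltW.
move=> j; apply: (subcell _ (- (j.+1%:R * delta))).
  apply: measurableI => //; rewrite (_ : [set w | _] =
    v @^-1` `]- (j.+1%:R * delta), - (j%:R * delta)]%classic).
    exact: mpre.
  apply/seteqP; split=> w /=; rewrite in_itv/= => /andP[jv vj].
    by rewrite ltrNl vj lerNr.
  by rewrite lerNr vj ltrNl.
move=> w [[Dw _] /= /andP[jv /ltW vj]]; split=> //=.
by rewrite lerNl vj/= succE opprD subrK lerNr.
Qed.

(** Integrating over an arbitrary domain [D] lets the cells of one coordinate be
    absorbed in [D] while the other coordinates are treated. *)
Lemma integral_prod_fejer_le (I : eqType) (y : I -> T -> R) (q : R) :
  (forall i, measurable_fun [set: T] (y i)) ->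
  forall (s : seq I) (D : set T), uniq s -> measurable D ->
    (forall x : I -> R, (P (D `&`
      [set w | forall i, i \in s -> (x i <= y i w <= x i + delta)%R]) <= q%:E)%E) ->
  (\int[P]_(w in D) (\prod_(i <- s) fejer (y i w))%:E <=
    ((24 / delta) ^+ size s * q)%:E)%E.
Proof.
move=> my; elim=> [|k s IHs] D us mD Dq.
  under eq_integral do rewrite big_nil.
  rewrite integral_cst// mul1e expr0 mul1r; apply: le_trans (Dq (fun=> 0)).
  by rewrite (_ : _ `&` _ = D)//; apply/seteqP; split=> [w []//|w Dw]; split.
have /andP[ks {}us] := us.
under eq_integral do rewrite big_cons.
rewrite exprS -mulrA; apply: integral_cells_twosided => //.
- apply: measurable_prod => i _.
  exact: measurableT_comp (@measurable_fejer R) (my i).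
- by move=> w; apply: prodr_ge0 => i _; exact: fejer_ge0.
move=> x; apply: IHs => //.
  apply: measurableI => //; rewrite (_ : [set w | _] =
    y k @^-1` `[x, x + delta]%classic).
    by rewrite -[X in measurable X]setTI; exact: my.
  by apply/seteqP; split=> w /=; rewrite in_itv.
move=> x'; apply: le_trans (Dq (fun i => if i == k then x else x' i)).
rewrite le_eqVlt; apply/orP; left; apply/eqP; congr (P _).
apply/seteqP; split=> w.
  move=> [[Dw /= xk] xs]; split=> //= i; rewrite inE.
  by case: eqP => [-> _//|_ /= is_]; exact: xs.
move=> [Dw /= xs]; split; [split=> //|].
  by have := xs k; rewrite inE eqxx; exact.
move=> i is_; have := xs i; rewrite inE is_ orbT.
have -> : (i == k) = false by apply: contraNF ks => /eqP <-.
exact.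
Qed.

(** The cells of all coordinates are boxes of side [delta], so a uniform bound on
    the probabilities of such boxes bounds the smoothed probability. *)
Lemma expectation_prod_fejer_le (I : finType) (y : I -> T -> R) (q : R) :
  (forall i, measurable_fun [set: T] (y i)) ->
  (forall x : I -> R,
    (P [set w | forall i, (x i <= y i w <= x i + delta)%R] <= q%:E)%E) ->
  \int[P]_w \prod_i fejer (y i w) <= (24 / delta) ^+ #|I| * q.
Proof.
move=> my boxq.
have bprod : bounded_measurable (fun w => \prod_i fejer (y i w)).
  apply: bounded_measurable_prod => i; split.
    exact: measurableT_comp (@measurable_fejer R) (my i).
  by exists 1 => w; rewrite ger0_norm ?fejer_ge0 ?fejer_le1.
rewrite -lee_fin EFin_expectation//.
have -> : #|I| = size (index_enum I) by rewrite [index_enum _]unlock -enumT cardE.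
apply: integral_prod_fejer_le => //; first exact: index_enum_uniq.
move=> x; rewrite setTI; apply: le_trans (boxq x).
rewrite le_eqVlt; apply/orP; left; apply/eqP; congr (P _).
apply/seteqP; split=> w /= wx i; first exact: wx (mem_index_enum i).
by move=> _; exact: wx.
Qed.

End fejer_cells.


(** * Concentration functions and characteristic functions *)

Section concentration.
Context (R : realType) (d : nat).
Implicit Types x y : 'rV[R]_d.

Lemma ballE x (r : R) : 0 < r ->
  [set x + r *: b | b in @half_ball R d] = [set y | enorm (y - x) <= r / 2].
Proof.
move=> r0; have r_neq0 := lt0r_neq0 r0.
have enormZ (c : R) v : 0 <= c -> enorm (c *: v) = c * enorm v :> R.
  move=> c0; rewrite /enorm dotpZl dotpZr mulrA -expr2.
  by rewrite sqrtrM ?sqr_ge0// sqrtr_sqr ger0_norm.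
apply/seteqP; split=> y /=.
  move=> [b + <-]; rewrite /half_ball/= addrC addKr => bh.
  by rewrite enormZ ?(ltW r0)// ler_pM2l// -(mul1r 2^-1).
move=> yx; exists (r^-1 *: (y - x)).
  rewrite /half_ball/= enormZ ?invr_ge0 ?(ltW r0)// ler_pdivrMl//.
  by rewrite mul1r.
by rewrite scalerA mulfV// scale1r addrC subrK.
Qed.

Lemma measurable_ball x (r : R) : 0 < r ->
  measurable [set x + r *: b | b in @half_ball R d].
Proof.
move=> r0; rewrite ballE//.
have mf : measurable_fun [set: 'rV[R]_d] (fun y => dotp (y - x) (y - x)).
  have mB : measurable_fun [set: 'rV[R]_d] (fun y : 'rV[R]_d => y - x).
    apply/measurable_fun_rowP => i; under eq_fun do rewrite !mxE.
    by apply: measurable_funB => //; exact: measurable_fun_coord.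
  exact: measurable_fun_dotp.
rewrite (_ : [set y | _] =
  (fun y => dotp (y - x) (y - x)) @^-1` `]-oo, (r / 2) ^+ 2]%classic).
  by rewrite -[X in measurable X]setTI; exact: mf.
apply/seteqP; split=> y /=; rewrite in_itv/= /enorm => yr.
  have dge0 : 0 <= dotp (y - x) (y - x).
    by apply: sumr_ge0 => i _; rewrite -expr2 sqr_ge0.
  rewrite -(sqr_sqrtr dge0) lerXn2r ?nnegrE ?sqrtr_ge0//.
  by rewrite divr_ge0// ltW.
rewrite -[leRHS]ger0_norm ?divr_ge0 ?(ltW r0)//.
by rewrite -sqrtr_sqr ler_sqrt// sqr_ge0.
Qed.

Lemma coord_ball x y (r : R) (i : 'I_d) : 0 <= r ->
  enorm (y - x) <= r -> `|y 0 i - x 0 i| <= r.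
Proof.
move=> r0; apply: le_trans; rewrite /enorm -sqrtr_sqr ler_sqrt; last first.
  by apply: sumr_ge0 => j _; rewrite -expr2 sqr_ge0.
rewrite /dotp (bigD1 i)//= !mxE -expr2 lerDl.
by apply: sumr_ge0 => j _; rewrite -expr2 sqr_ge0.
Qed.

(** A cube of side 2 r / d lies in the ball of radius r, by the crude bound
    d * (1 / d) ^ 2 <= 1. *)
Lemma ball_of_coord x y (r : R) : (0 < d)%N -> 0 <= r ->
  (forall i, `|y 0 i - x 0 i| <= r / d%:R) -> enorm (y - x) <= r.
Proof.
move=> d0 r0 yx; have dr0 : 0 < d%:R :> R by rewrite ltr0n.
rewrite /enorm -[leRHS]ger0_norm// -sqrtr_sqr ler_sqrt ?sqr_ge0//.
apply: (@le_trans _ _ (\sum_(i < d) (r / d%:R) ^+ 2)).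
  apply: ler_sum => i _; rewrite !mxE -expr2.
  by rewrite -(real_normK (num_real _)) lerXn2r ?nnegrE// divr_ge0// ltW.
rewrite sumr_const card_ord -[leLHS]mulr_natl expr_div_n.
rewrite (_ : _ * _ = r ^+ 2 / d%:R); last by field; rewrite gt_eqF.
by rewrite ler_pdivrMr// ler_peMr ?sqr_ge0// ler1n.
Qed.

Lemma measurable_box (I : finType) disp (T : measurableType disp)
    (y : I -> T -> R) (a b : I -> R) :
  (forall i, measurable_fun [set: T] (y i)) ->
  measurable [set w | forall i, a i <= y i w <= b i].
Proof.
move=> my; rewrite [X in measurable X](_ : _ = \bigcap_(i in [set: I])
    y i @^-1` `[a i, b i]%classic).
  apply: fin_bigcap_measurable => // i _.
  by rewrite -[X in measurable X]setTI; exact: my.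
apply/seteqP; split=> w /= wab i; first by move=> _; rewrite /= in_itv/=.
by have := wab i Logic.I; rewrite /= in_itv.
Qed.

Lemma box_le_concentration (H : probability 'rV[R]_d R) (r : R) (x : 'I_d -> R) :
  (0 < d)%N -> 0 < r ->
  (H [set y | forall i, (x i <= y 0 i <= x i + r / d%:R)%R] <=
    concentration H r)%E.
Proof.
move=> d0 r0; have dr0 : 0 < d%:R :> R by rewrite ltr0n.
pose c : 'rV[R]_d := \row_i (x i + r / 2 / d%:R).
apply: (@le_trans _ _ (H [set c + r *: b | b in @half_ball R d])); last first.
  by apply: ereal_sup_ubound; exists c.
apply: le_measure; rewrite ?inE; [|exact: measurable_ball|].
  by apply: measurable_box => i; exact: measurable_coordinate.
rewrite ballE// => y /= yx; apply: ball_of_coord => //.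
  by rewrite divr_ge0// ltW.
move=> i; rewrite mxE ler_norml; have /andP[h1 h2] := yx i.
have e : r / 2 / d%:R + r / 2 / d%:R = r / d%:R by field; rewrite gt_eqF.
by apply/andP; split; lra.
Qed.

Lemma concentration_fin (H : probability 'rV[R]_d R) (r : R) : 0 < r ->
  exists2 q : R, 0 <= q & concentration H r = q%:E.
Proof.
move=> r0.
have c0 : (0 <= concentration H r)%E.
  apply: (@le_trans _ _ (H [set 0 + r *: b | b in @half_ball R d])) => //.
  by apply: ereal_sup_ubound; exists 0.
have c1 : (concentration H r <= 1)%E.
  apply: ge_ereal_sup => _ [x _ <-]; apply: probability_le1.
  exact: measurable_ball.
exists (fine (concentration H r)); first exact: fine_ge0.
by rewrite fineK// ge0_fin_numE// (le_lt_trans c1)// ltry.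
Qed.

(** In the scaled variable [u *: y], boxes of side [delta] come from boxes of
    side delta / `|u|, which are covered by single balls of the concentration
    function at [eps]. *)
Lemma expectation_fejer_kernel_le (H : probability 'rV[R]_d R) (eps u delta q : R) :
  (0 < d)%N -> 0 < eps -> u != 0 -> 0 < delta <= 1 ->
  delta / `|u| <= eps / d%:R -> concentration H eps = q%:E ->
  \int[H]_y fejer_kernel (u *: y) <= (24 / delta) ^+ d * q.
Proof.
move=> d0 eps0 u0 delta01 du Hq; have /andP[delta0 _] := delta01.
have u_gt0 : 0 < `|u| by rewrite normr_gt0.
have mcoord i : measurable_fun [set: 'rV[R]_d] (fun y : 'rV[R]_d => u * y 0 i).
  by apply: measurable_funM => //; exact: measurable_fun_coord.
have -> : \int[H]_y fejer_kernel (u *: y) =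
    \int[H]_y \prod_(i < d) fejer (u * y 0 i).
  by apply: eq_Rintegral => y _; apply: eq_bigr => i _; rewrite mxE.
rewrite -[d in leRHS]card_ord; apply: expectation_prod_fejer_le => // x.
rewrite -Hq.
(* The lower ends of the box in the variable y; scaling by u < 0 swaps the
   ends. *)
pose x' i := if 0 < u then x i / u else (x i + delta) / u.
apply: le_trans (box_le_concentration H x' d0 eps0).
apply: le_measure; rewrite ?inE; [exact: measurable_box| |].
  by apply: measurable_box => i; exact: measurable_coordinate.
move=> y /= xy i; have /andP[h1 h2] := xy i; rewrite /x'.
have [up|un] := ltP 0 u.
  rewrite ler_pdivrMr// (mulrC _ u) h1/=.
  apply: le_trans (lerD (lexx _) du).
  by rewrite gtr0_norm// -mulrDl ler_pdivlMr// (mulrC _ u).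
have {}un : u < 0 by rewrite lt_neqAle u0.
rewrite ler_ndivrMr// (mulrC _ u) h2/=.
apply: le_trans (lerD (lexx _) du).
rewrite ltr0_norm// invrN mulrN -mulNr -mulrDl addrK.
by rewrite ler_ndivlMr// (mulrC _ u).
Qed.

End concentration.
Section esseen.
Context (R : realType) (d : nat) (nu : probability 'rV[R]_d R).
Hypothesis nu_fejer :
  forall x, \int[nu]_t cos (dotp t x) = fejer_kernel x.

Lemma bounded_measurable_fejer_kernel : bounded_measurable (@fejer_kernel R d).
Proof.
apply: bounded_measurable_prod => i; split.
  by apply: measurableT_comp (@measurable_fejer R) _; exact: measurable_coordinate.
by exists 1 => y; rewrite ger0_norm ?fejer_ge0 ?fejer_le1.
Qed.

Lemma fejer_kernel_ge0 (x : 'rV[R]_d) : 0 <= fejer_kernel x.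
Proof. by apply: prodr_ge0 => i _; exact: fejer_ge0. Qed.

Lemma ball_indicator_le_fejer_kernel (x y : 'rV[R]_d) (tau : R) : 0 < tau ->
  fejer_min R ^+ d * \1_[set x + tau *: b | b in @half_ball R d] y <=
  fejer_kernel (tau^-1 *: (y - x)).
Proof.
move=> tau0; rewrite indicE; case: (boolP (_ \in _)) => [|_]; last first.
  by rewrite mulr0 fejer_kernel_ge0.
rewrite inE ballE// => /= yx; rewrite mulr1.
rewrite -[d in leLHS]card_ord -prodr_const; apply: ler_prod => i _.
rewrite (ltW (fejer_min_gt0 R))/=; apply: fejer_ge_min.
rewrite !mxE normrM gtr0_norm ?invr_gt0// ler_pdivrMl// mul1r.
by apply: coord_ball => //; rewrite divr_ge0// ltW.
Qed.

(** Esseen's inequality: the kernel dominates the indicator of the ball up to the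
    factor [fejer_min], and averaging the kernel over [S] averages the
    characteristic function of [S] over [nu]. The function [psi] is any upper
    bound of the modulus of that characteristic function. *)
Lemma ball_prob_le_char_fun disp (T : measurableType disp) (P : probability T R)
    (S : {RV P >-> 'rV[R]_d}) (tau : R) (x : 'rV[R]_d) (psi : 'rV[R]_d -> R) :
  0 < tau -> bounded_measurable psi ->
  (forall t, \int[P]_w cos (dotp (tau^-1 *: t) (S w) - dotp (tau^-1 *: t) x) <=
    psi t) ->
  fejer_min R ^+ d *
    fine (distribution P S [set x + tau *: b | b in @half_ball R d]) <=
  \int[nu]_t psi t.
Proof.
move=> tau0 bpsi psi_ge; have mball := measurable_ball x tau0.
have mS : measurable_fun [set: T] S by exact: measurable_funPT.
have bball := @bounded_measurable_indic _ _ R _ mball.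
rewrite -(expectation_indicator _ mball) -expectation_scale//.
have mphase : measurable_fun [set: 'rV[R]_d * T]
    (fun p => dotp (tau^-1 *: p.1) (S p.2) - dotp (tau^-1 *: p.1) x).
  have mt : measurable_fun [set: 'rV[R]_d * T] (fun p => tau^-1 *: p.1).
    exact: measurable_fun_scale.
  apply: measurable_funB; apply: measurable_fun_dotp => //.
  exact: measurableT_comp.
have bphase := bounded_measurable_cos mphase.
apply: le_trans (expectation_mono _ (bounded_measurable_fubini1 nu P bphase)
  bpsi psi_ge).
rewrite (expectation_fubini nu P bphase) /=.
rewrite expectation_distribution; last first.
  exact: bounded_measurableM (bounded_measurable_cst _) bball.
have kE w : \int[nu]_t cos (dotp (tau^-1 *: t) (S w) - dotp (tau^-1 *: t) x) =
    fejer_kernel (tau^-1 *: (S w - x)).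
  rewrite -nu_fejer; apply: eq_Rintegral => t _.
  by rewrite dotpZr dotpBr mulrBr !dotpZl.
under [leRHS]eq_Rintegral do rewrite kE.
apply: expectation_mono => [||w].
- apply: bounded_measurableM (bounded_measurable_cst _) _.
  exact: bounded_measurable_comp bball mS.
- apply: bounded_measurable_comp bounded_measurable_fejer_kernel _.
  apply: measurable_fun_scale => //; apply/measurable_fun_rowP => i.
  under eq_fun do rewrite !mxE.
  by apply: measurable_funB => //; exact: measurable_fun_coord.
exact: ball_indicator_le_fejer_kernel.
Qed.

(** The same exchange of integrals read in the other direction: averaging a real
    characteristic function over [nu] smooths the law at scale 1 / u. *)
Lemma expectation_char_fun_real (H : probability 'rV[R]_d R) (u : R) :
  \int[nu]_t \int[H]_y cos (dotp (u *: t) y) =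
  \int[H]_y fejer_kernel (u *: y).
Proof.
have mdot : measurable_fun [set: 'rV[R]_d * 'rV[R]_d]
    (fun p => dotp (u *: p.1) p.2).
  by apply: measurable_fun_dotp => //; exact: measurable_fun_scale.
rewrite (expectation_fubini nu H (bounded_measurable_cos mdot)) /=.
apply: eq_Rintegral => y _; rewrite -nu_fejer.
by apply: eq_Rintegral => t _; rewrite dotpZl dotpZr.
Qed.

End esseen.

(** * The integrand of lambda *)

Section lambda_integrand_facts.
Context (R : realType) (d : nat) (eps tau : R).
Hypotheses (eps_gt0 : 0 < eps) (tau_gt0 : 0 < tau).

(** With the strict convention for the integer part, 1 plus the integer part of x
    is the ceiling of x. *)
Definition cells (z : R) : R := (Num.ceil (tau * (eps * `|z|)^-1))%:~R.

Lemma lambda_integrandE z :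
  lambda_integrand d eps tau z = if z == 0 then 0 else cells z ^- d.
Proof. by rewrite /lambda_integrand /strict_floor rmorphB/= addrC subrK. Qed.

Lemma cells_ge z : tau / (eps * `|z|) <= cells z.
Proof. exact: ceil_ge. Qed.

Lemma cells_ge1 z : z != 0 -> 1 <= cells z.
Proof.
move=> z0; rewrite /cells ler1z -gtz0_ge1 ceil_gt0.
by rewrite mulr_gt0// invr_gt0 mulr_gt0// normr_gt0.
Qed.

Lemma lambda_integrand_itv z : 0 <= lambda_integrand d eps tau z <= 1.
Proof.
rewrite lambda_integrandE; have [_|z0] := eqVneq z 0; first by rewrite lexx ler01.
have c1 := cells_ge1 z0; have c0 : 0 < cells z by exact: lt_le_trans c1.
by rewrite invr_ge0 exprn_ge0 ?(ltW c0)//= invf_le1 ?exprn_gt0// exprn_ege1.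
Qed.

Lemma measurable_lambda_integrand :
  measurable_fun [set: R] (lambda_integrand d eps tau).
Proof.
(* V is nondecreasing, and the integrand is V of the absolute value. *)
pose V (s : R) := if s <= 0 then 0 else lambda_integrand d eps tau s.
have V_nd : nondecreasing_fun V.
  move=> s t st; rewrite /V; have [t0|t0] := leP t 0.
    by rewrite (le_trans st t0).
  have [s0|s0] := leP s 0; first by case/andP: (lambda_integrand_itv t).
  rewrite !lambda_integrandE !gt_eqF//.
  have [cs1 ct1] := (cells_ge1 (lt0r_neq0 s0), cells_ge1 (lt0r_neq0 t0)).
  have [cs0 ct0] := (lt_le_trans ltr01 cs1, lt_le_trans ltr01 ct1).
  rewrite lef_pV2 ?posrE ?exprn_gt0// lerXn2r ?nnegrE ?(ltW cs0) ?(ltW ct0)//.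
  rewrite /cells ler_int le_ceil// ler_pM2l//.
  rewrite lef_pV2 ?posrE ?mulr_gt0 ?normr_gt0 ?gt_eqF//.
  by rewrite ler_pM2l// !gtr0_norm.
have -> : lambda_integrand d eps tau = V \o Num.norm.
  apply/funext => z; rewrite /V /= normr_le0.
  rewrite !lambda_integrandE normr_eq0 /cells normr_id.
  by case: ifP.
apply: measurableT_comp => //; exact: nondecreasing_measurable.
Qed.

Lemma bounded_lambda_integrand :
  bounded_measurable (lambda_integrand d eps tau).
Proof.
split; first exact: measurable_lambda_integrand.
by exists 1 => z; have /andP[w0 w1] := lambda_integrand_itv z; rewrite ger0_norm.
Qed.

(** Smoothing at scale tau / `|z|, which is at most [cells z] times eps, costs
    [cells z] to the power d in terms of the concentration function at eps. The
    exponent in the integrand of lambda is there to cancel this factor. *)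
Lemma lambda_integrand_fejer_le (H : probability 'rV[R]_d R) (q z : R) :
  (0 < d)%N -> concentration H eps = q%:E -> 0 <= q ->
  lambda_integrand d eps tau z *
    (\int[H]_y fejer_kernel ((z / tau) *: y)) <= (24 * d%:R) ^+ d * q.
Proof.
move=> d0 Hq q0; have dR : 1 <= d%:R :> R by rewrite ler1n.
have dR0 : 0 < d%:R :> R by exact: lt_le_trans dR.
rewrite lambda_integrandE; have [_|z0] := eqVneq z 0.
  by rewrite mul0r mulr_ge0// exprn_ge0// mulr_ge0.
have c1 := cells_ge1 z0; have c0 : 0 < cells z by exact: lt_le_trans c1.
rewrite ler_pdivrMl ?exprn_gt0// mulrA -exprMn.
have -> : cells z * (24 * d%:R) = 24 / (cells z * d%:R)^-1.
  by rewrite invrK mulrCA.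
apply: (expectation_fejer_kernel_le d0 eps_gt0 _ _ _ Hq).
- by rewrite mulf_neq0// invr_neq0// gt_eqF.
- by rewrite invr_gt0 mulr_gt0//= invf_le1 ?mulr_gt0// mulr_ege1.
- rewrite normrM normfV (gtr0_norm tau_gt0).
  have z_gt0 : 0 < `|z| by rewrite normr_gt0.
  have := cells_ge z; rewrite ler_pdivrMr ?mulr_gt0// => ctau.
  rewrite ler_pdivrMr ?divr_gt0// -(mul1r (_^-1)) ler_pdivrMr ?mulr_gt0//.
  rewrite (_ : eps / d%:R * _ * _ = cells z * (eps * `|z|) / tau).
    by rewrite ler_pdivlMr// mul1r.
  by field; rewrite !gt_eqF.
Qed.

End lambda_integrand_facts.

(** * The theorem *)

Theorem corollary2 (R : realType) (d : nat) (d_ge1 : (1 <= d)%N) :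
  exists c : R, 0 < c /\
  forall (n : nat) (n_ge1 : (1 <= n)%N)
    (disp : measure_display) (T : measurableType disp) (P : probability T R)
    (X : {RV P >-> R}) (Xs : 'I_n -> {RV P >-> R})
    (Xs_iid : iid (fun k : option 'I_n => if k is Some i then Xs i else X))
    (a : 'I_n -> 'rV[R]_d) (eps tau : R) (eps_gt0 : 0 < eps)
    (tau_gt0 : 0 < tau),
  let Fa := distribution P (weighted_sum Xs a) in
  let G := symmetrized_distribution X in
  let lam := lambda d G eps tau in
  0 < lam ->
  forall H1lam : probability 'rV[R]_d R,
  (forall t : 'rV[R]_d, char_fun H1lam t =
     (expR (- (lam / 2) * \sum_(k < n) (1 - cos (dotp t (a k)))))%:C) ->
  (concentration Fa tau <= (c * lam^-1)%:E * concentration H1lam eps)%E.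
Proof.
exists ((24 * d%:R) ^+ d / fejer_min R ^+ d).
have min_gt0 : 0 < fejer_min R ^+ d by exact: exprn_gt0 (fejer_min_gt0 R).
have dR0 : 0 < d%:R :> R by rewrite ltr0n.
split; first by apply: divr_gt0 => //; rewrite exprn_gt0// mulr_gt0.
move=> n _ disp T P X Xs Xs_iid a eps tau eps_gt0 tau_gt0 Fa G lam lam_gt0 H HE.
have [q q0 Hq] := concentration_fin H eps_gt0.
have [nu nuE] := fejer_law_product R d.
set W := lambda_integrand d eps tau.
have bW : bounded_measurable W by exact: bounded_lambda_integrand.
have W01 z : 0 <= W z <= 1 by exact: lambda_integrand_itv.
pose h (t : 'rV[R]_d) z :=
  2^-1 * \sum_k (1 - cos (dotp (tau^-1 *: t) (a k) * z)).
have h_ge0 t z : 0 <= h t z.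
  by rewrite mulr_ge0// sumr_ge0// => k _; rewrite subr_ge0 cos_le1.
have mphase k : measurable_fun [set: 'rV[R]_d * R]
    (fun p => dotp (tau^-1 *: p.1) (a k) * p.2).
  apply: measurable_funM => //.
  by apply: measurable_fun_dotp => //; exact: measurable_fun_scale.
have bcos k := bounded_measurableB (bounded_measurable_cst 1)
  (bounded_measurable_cos (mphase k)).
have bh : bounded_measurable (fun p => h p.1 p.2).
  apply: bounded_measurableM; first exact: bounded_measurable_cst.
  exact: bounded_measurable_sum.
have bht t : bounded_measurable (h t).
  exact: bounded_measurable_comp bh (pair1_measurable t).
have bjoint : bounded_measurable (fun p : 'rV[R]_d * R =>
    W p.2 * expR (- (lam * h p.1 p.2))).
  apply: bounded_measurableM; first exact: bounded_measurable_comp bW _.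
  apply: bounded_measurable_expRN => [|p]; last by rewrite mulr_ge0// ltW.
  by apply: measurable_funM => //; case: bh.
(* The bound on the characteristic function of the weighted sum, uniform in the
   centre x of the ball. *)
have Fa_le x t : \int[P]_w cos (dotp (tau^-1 *: t) (weighted_sum Xs a w) -
      dotp (tau^-1 *: t) x) <=
    lam^-1 * \int[G]_z (W z * expR (- (lam * h t z))).
  apply: le_trans (weighted_sum_cos_le _ _ _ Xs_iid) _.
  apply: le_trans (expR_expectation_le bW (bht t) W01 (h_ge0 t) lam_gt0).
  rewrite ler_expR le_eqVlt; apply/orP; left; apply/eqP.
  rewrite mulNr; congr (- _); rewrite expectation_scale; last first.
    by apply: bounded_measurable_sum => k;
      exact: bounded_measurable_comp (bcos k) (pair1_measurable t).
  congr (_ * _); rewrite expectation_sum_fin => [|k]; last first.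
    exact: bounded_measurable_comp (bcos k) (pair1_measurable t).
  apply: eq_bigr => k _; rewrite expectation_sub.
  - by rewrite expectation_constant.
  - exact: bounded_measurable_cst.
  - by apply: bounded_measurable_cos; exact: measurable_funM.
(* exp (- lam h (t, z)) is the characteristic function of H at z t / tau. *)
have H_le z : \int[nu]_t (W z * expR (- (lam * h t z))) <=
    (24 * d%:R) ^+ d * q.
  have bz : bounded_measurable (fun t => expR (- (lam * h t z))).
    apply: bounded_measurable_expRN => [|t]; last by rewrite mulr_ge0// ltW.
    apply: measurable_funM => //.
    exact: (bounded_measurable_comp bh (pair2_measurable z)).1.
  rewrite expectation_scale//.
  rewrite (_ : \int[nu]_t _ = \int[H]_y fejer_kernel ((z / tau) *: y)).
    exact: lambda_integrand_fejer_le.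
  rewrite -(expectation_char_fun_real nuE H); apply: eq_Rintegral => t _.
  have /(congr1 (@complex.Re R)) /= -> := HE ((z / tau) *: t).
  congr expR; rewrite /h mulrA -mulNr; congr (_ * _).
  apply: eq_bigr => k _; congr (1 - cos _).
  by rewrite !dotpZl; ring.
rewrite Hq -EFinM; apply: ge_ereal_sup => _ [x _ <-].
have mball := measurable_ball x tau_gt0.
rewrite -[X in (X <= _)%E]fineK ?fin_num_measure// lee_fin.
rewrite (_ : _ / _ / lam * q = (fejer_min R ^+ d)^-1 *
  (lam^-1 * ((24 * d%:R) ^+ d * q))); last by ring.
rewrite ler_pdivlMl//.
have bG := bounded_measurable_fubini1 nu G bjoint.
apply: le_trans (ball_prob_le_char_fun nuE tau_gt0
  (bounded_measurableM (bounded_measurable_cst lam^-1) bG) (Fa_le x)) _.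
rewrite expectation_scale//.
rewrite ler_pM2l ?invr_gt0// (expectation_fubini nu G bjoint)/=.
rewrite -[leRHS](expectation_constant G); apply: expectation_mono.
- exact: (bounded_measurable_fubini2 nu G bjoint).
- exact: bounded_measurable_cst.
- exact: H_le.
Qed.
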